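(* Consider Problem (P) under Assumption (A) over a graph satisfying Assumption (B), and run SONATA with weights satisfying (W) and surrogates satisfying (C), with $\tilde\mu_{\min}\ge D^\ell_{\min}$. Define $\bar a=\tilde\mu_{\min}/(\tilde\mu_{\min}-D^\ell_{\min})$ (interpreted as $+\infty$ if $\tilde\mu_{\min}=D^\ell_{\min}$, in which case $G_P^\star$ below is constant in $\alpha$ and $G_P^\star(\bar a)$ denotes that constant), $$G_P^\star(\alpha)=\frac{\frac{D_{\max}^2}{\mu}+\frac1\mu\big((1-\frac\alpha2)\tilde\mu_{\min}+\frac{D^\ell_{\min}}2\alpha\big)^2}{\big((1-\frac\alpha2)\tilde\mu_{\min}+\frac{D^\ell_{\min}}2\alpha\big)^2},\quad C_1=\frac6\mu\Big(\big(\tfrac{D_{\max}}{\tilde\mu_{\min}}+1\big)^2+\frac{4L_{\max}^2}{\tilde\mu_{\min}^2}\Big),\quad C_2=\frac4{\tilde\mu_{\min}^2},$$ $A_1=2G_P^\star(\bar a)C_1\cdot4L_{\max}^2\rho^2$, $A_2=(4G_P^\star(\bar a)C_1+C_2)\cdot2L_{\max}^2\rho^2$, $A_3=(4G_P^\star(\bar a)C_1+C_2)\cdot8L_{\max}^2\rho^4$, $A_{1/2}=\sqrt{A_1+A_2+A_3}$, $J=\frac12\cdot\frac{\tilde\mu_{\min}\mu}{4D_{\max}^2+\tilde\mu_{\min}\mu}$, $$\alpha^*=\Big(\frac{-\rho\sqrt{A_{1/2}}+\sqrt{A_{1/2}+J(1-\rho^2)}}{A_{1/2}+J}\Big)^2,\qquad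 \alpha_{\max}=\min\Big\{\frac{(1-\rho)^2}{A_{1/2}},\ \bar a,\ 1\Big\}.$$ If $\alpha\in(0,\alpha_{\max})$, then for all $i\in\{1,\dots,m\}$, $U(x_i^\nu)-U^\star=O(z^\nu)$, where $z=1-J\alpha$ if $\alpha\in(0,\min\{\alpha^*,\alpha_{\max}\})$, and $z=\big(\rho+\sqrt{\alpha A_{1/2}}\big)^2$ if $\alpha\in[\min\{\alpha^*,\alpha_{\max}\},\alpha_{\max})$.
   Context: Problem (P): minimize $U(x):=F(x)+G(x)$ over $x\in\mathcal K$, $F=\frac1m\sum_{i=1}^mf_i$. Assumption (A): $\mathcal K\subseteq\mathbb R^d$ nonempty closed convex; each $f_i$ twice differentiable and convex on an open $\mathcal O\supseteq\mathcal K$; $\mu I\preceq\nabla^2F(x)\preceq LI$ on $\mathcal K$ with $\mu>0,L<\infty$; $G:\mathcal K\to\mathbb R$ convex. $U^\star$ is the optimal value. For each $i$, $\nabla^2f_i(x)\preceq L_iI$ on $\mathcal K$ with $L_i<\infty$; $L_{\max}=\max_iL_i$. (B): connected undirected graph on $\{1,\dots,m\}$ with edges $\mathcal E$. (W): $w_{ii}>0$; for $i\ne j$, $w_{ij}>0$ iff $(i,j)\in\mathcal E$, else $0$; $W$ doubly stochastic. $\rho$ is the largest singular value of $W\otimes I_d-\frac1m\mathbf 1\mathbf 1^\top\otimes I_d$ (so $\rho<1$). (C): $\tilde f_i:\mathcal O\times\mathcal O\to\mathbb R$ is $C^2$, $\nabla\tilde f_i(x;x)=\nabla f_i(x)$,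 $\nabla\tilde f_i(\cdot;x)$ is $\tilde L_i$-Lipschitz and $\tilde f_i(\cdot;x)$ is $\tilde\mu_i$-strongly convex on $\mathcal K$, for all $x\in\mathcal K$ (derivatives in the first argument). Constants $D_i^\ell\le D_i^u$ satisfy $D_i^\ell I\preceq\nabla^2\tilde f_i(x;y)-\nabla^2F(x)\preceq D_i^uI$ for all $x,y\in\mathcal K$; $D_i=\max\{|D_i^\ell|,|D_i^u|\}$, $\tilde\mu_{\min}=\min_i\tilde\mu_i$, $D^\ell_{\min}=\min_iD_i^\ell$, $D_{\max}=\max_iD_i$. SONATA with step-size $\alpha$: $x_i^0\in\mathcal K$, $y_i^0=\nabla f_i(x_i^0)$; $\hat x_i^\nu=\arg\min_{x_i\in\mathcal K}\tilde f_i(x_i;x_i^\nu)+(y_i^\nu-\nabla f_i(x_i^\nu))^\top(x_i-x_i^\nu)+G(x_i)$; $x_i^{\nu+1/2}=x_i^\nu+\alpha(\hat x_i^\nu-x_i^\nu)$; $x_i^{\nu+1}=\sum_jw_{ij}x_j^{\nu+1/2}$; $y_i^{\nu+1}=\sum_jw_{ij}(y_j^\nu+\nabla f_j(x_j^{\nu+1})-\nabla f_j(x_j^\nu))$. *)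

(* Defs.v *)
From HB Require Import structures.
From mathcomp Require Import all_boot all_order all_algebra.
From mathcomp Require Import all_classical all_reals all_analysis.
From mathcomp Require Import mxtens.
Import numFieldNormedType.Exports.

Set Implicit Arguments.
Unset Strict Implicit.
Unset Printing Implicit Defensive.

Import Order.TTheory GRing.Theory Num.Theory.
Local Open Scope classical_set_scope.
Local Open Scope ring_scope.

Section Defs.
Variable R : realType.

Definition dotp {d : nat} (u v : 'rV[R]_d) : R := (u *m v^T) 0 0.
Definition enorm {d : nat} (u : 'rV[R]_d) : R := Num.sqrt (dotp u u).
Definition ebase {d : nat} (j : 'I_d) : 'rV[R]_d := delta_mx 0 j.

Definition grad {d : nat} (f : 'rV[R]_d -> R) (x : 'rV[R]_d) : 'rV[R]_d :=
  \row_j derive f x (ebase j).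
Definition hess {d : nat} (f : 'rV[R]_d -> R) (x : 'rV[R]_d) : 'M[R]_d :=
  \matrix_(i, j) derive (fun y => derive f y (ebase j)) x (ebase i).

Definition loewner_le {d : nat} (A B : 'M[R]_d) : Prop :=
  forall u : 'rV[R]_d, dotp (u *m A) u <= dotp (u *m B) u.

Definition twice_diff_fun_on {d : nat} (A : set 'rV[R]_d) (f : 'rV[R]_d -> R) :=
  forall x, A x -> differentiable f x /\
    forall j : 'I_d, differentiable (fun y => derive f y (ebase j)) x.

Definition C2_fun_on (V : normedModType R) (A : set V) (f : V -> R) :=
  (forall x, A x -> differentiable f x /\
     forall v : V, differentiable (fun y => derive f y v) x) /\
  (forall u v : V, {within A, continuous (fun y =>
      derive (fun z => derive f z v) y u)}).

Definition convex_setR {d : nat} (K : set 'rV[R]_d) :=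
  forall x y t, K x -> K y -> 0 <= t <= 1 -> K ((1 - t) *: x + t *: y).

Definition convex_fun_on {d : nat} (A : set 'rV[R]_d) (f : 'rV[R]_d -> R) :=
  forall x y t, A x -> A y -> 0 <= t <= 1 -> A ((1 - t) *: x + t *: y) ->
    f ((1 - t) *: x + t *: y) <= (1 - t) * f x + t * f y.

Definition strongly_convex_fun_on {d : nat} (A : set 'rV[R]_d) (mu : R)
    (f : 'rV[R]_d -> R) :=
  forall x y t, A x -> A y -> 0 <= t <= 1 -> A ((1 - t) *: x + t *: y) ->
    f ((1 - t) *: x + t *: y) <=
      (1 - t) * f x + t * f y - mu / 2 * t * (1 - t) * (enorm (x - y)) ^+ 2.

Definition grad_lipschitz_on {d : nat} (A : set 'rV[R]_d) (L : R)
    (g : 'rV[R]_d -> 'rV[R]_d) :=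
  forall x y, A x -> A y -> enorm (g x - g y) <= L * enorm (x - y).

Definition seqmin (s : seq R) : R :=
  if s is x :: s' then foldr Num.min x s' else 0.
Definition seqmax (s : seq R) : R :=
  if s is x :: s' then foldr Num.max x s' else 0.
Definition minf {m : nat} (a : 'I_m -> R) : R := seqmin [seq a i | i <- enum 'I_m].
Definition maxf {m : nat} (a : 'I_m -> R) : R := seqmax [seq a i | i <- enum 'I_m].

Definition connected_graph {m : nat} (E : rel 'I_m) :=
  (forall i j, E i j = E j i) /\ (forall i, ~~ E i i) /\
  (forall i j, connect E i j).

Definition weights_ok {m : nat} (E : rel 'I_m) (W : 'M[R]_m) :=
  (forall i, 0 < W i i) /\
  (forall i j, i != j -> (0 < W i j <-> E i j)) /\
  (forall i j, i != j -> ~~ E i j -> W i j = 0) /\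
  (forall i, \sum_j W i j = 1) /\ (forall j, \sum_i W i j = 1).

Definition largest_singular_value {n : nat} (M : 'M[R]_n) (rho : R) :=
  0 <= rho /\ eigenvalue (M^T *m M) (rho ^+ 2) /\
  forall a, eigenvalue (M^T *m M) a -> a <= rho ^+ 2.

Definition consensus_matrix (m d : nat) (W : 'M[R]_m) : 'M[R]_(m * d) :=
  W *t (1%:M : 'M[R]_d) - (m%:R)^-1 *: (const_mx 1 : 'M[R]_m) *t (1%:M : 'M[R]_d).

Definition avgF {m d : nat} (f : 'I_m -> 'rV[R]_d -> R) : 'rV[R]_d -> R :=
  fun z => (m%:R)^-1 * \sum_i f i z.

Definition sonata {m d : nat} (K : set 'rV[R]_d) (G : 'rV[R]_d -> R)
    (f : 'I_m -> 'rV[R]_d -> R) (ft : 'I_m -> 'rV[R]_d -> 'rV[R]_d -> R)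
    (W : 'M[R]_m) (alpha : R)
    (x xhat y : nat -> 'I_m -> 'rV[R]_d) :=
  (forall i, K (x 0%N i)) /\
  (forall i, y 0%N i = grad (f i) (x 0%N i)) /\
  (forall nu i, K (xhat nu i) /\
     forall z, K z ->
       ft i (xhat nu i) (x nu i)
         + dotp (y nu i - grad (f i) (x nu i)) (xhat nu i - x nu i)
         + G (xhat nu i)
       <= ft i z (x nu i) + dotp (y nu i - grad (f i) (x nu i)) (z - x nu i)
          + G z) /\
  (forall nu i, x nu.+1 i =
     \sum_j W i j *: (x nu j + alpha *: (xhat nu j - x nu j))) /\
  (forall nu i, y nu.+1 i =
     \sum_j W i j *: (y nu j + grad (f j) (x nu.+1 j) - grad (f j) (x nu j))).

Section Constants.
Variables (mu Lmax Dmax mutmin Dlmin rho : R).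

Definition abar : R := mutmin / (mutmin - Dlmin).
Definition sP (a : R) : R := (1 - a / 2) * mutmin + Dlmin / 2 * a.
Definition GP (a : R) : R :=
  (Dmax ^+ 2 / mu + mu^-1 * (sP a) ^+ 2) / (sP a) ^+ 2.
(* G_P^*(abar); when mutmin = Dlmin, G_P^* is constant and we take that value *)
Definition GPbar : R := if mutmin == Dlmin then GP 0 else GP abar.
Definition C1 : R :=
  6 / mu * ((Dmax / mutmin + 1) ^+ 2 + 4 * Lmax ^+ 2 / mutmin ^+ 2).
Definition C2 : R := 4 / mutmin ^+ 2.
Definition A1 : R := 2 * GPbar * C1 * (4 * Lmax ^+ 2 * rho ^+ 2).
Definition A2 : R := (4 * GPbar * C1 + C2) * (2 * Lmax ^+ 2 * rho ^+ 2).
Definition A3 : R := (4 * GPbar * C1 + C2) * (8 * Lmax ^+ 2 * rho ^+ 4).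
Definition Ahalf : R := Num.sqrt (A1 + A2 + A3).
Definition Jc : R := 1 / 2 * (mutmin * mu / (4 * Dmax ^+ 2 + mutmin * mu)).
Definition alpha_star : R :=
  ((- rho * Num.sqrt Ahalf + Num.sqrt (Ahalf + Jc * (1 - rho ^+ 2)))
     / (Ahalf + Jc)) ^+ 2.
(* alpha < alpha_max = min{(1-rho)^2/Ahalf, abar, 1}, where a term with a
   vanishing denominator is +oo *)
Definition below_alpha_max (a : R) : Prop :=
  (Ahalf = 0 \/ a < (1 - rho) ^+ 2 / Ahalf) /\
  (mutmin = Dlmin \/ a < abar) /\ a < 1.
Definition rate (a : R) : R :=
  if a < alpha_star then 1 - Jc * a
  else (rho + Num.sqrt (a * Ahalf)) ^+ 2.
End Constants.

End Defs.
Arguments consensus_matrix {R} m d W.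

(* Main.v *)
Require Import Defs.
From HB Require Import structures.
From mathcomp Require Import all_boot all_order all_algebra.
From mathcomp Require Import all_classical all_reals all_analysis.
From mathcomp Require Import mxtens ring lra.
Import numFieldNormedType.Exports.
Import Order.TTheory GRing.Theory Num.Theory.
Local Open Scope classical_set_scope.
Local Open Scope ring_scope.

Set Implicit Arguments.
Unset Strict Implicit.
Unset Printing Implicit Defensive.

(** Write [P] for the total optimality gap of the agents, [X] and [Y] for the
    consensus errors of the iterates and of the gradient trackers, and [E] for
    the total length of the directions [xhat - x].  One step of the algorithm
    couples these four sequences: [P] contracts up to [X^2 + Y^2] by a descent
    inequality for the surrogates, [X] and [Y] contract with factor [rho] up to
    [E] (and [X], for [Y]), and [E^2] is bounded by [P + Y^2].  If all of them
    decay like powers of [r = sqrt z], the constants have to satisfy a loop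
    inequality whose gain is at most [(alpha * Ahalf)^2 / (r - rho)^4 <= 1];
    since the bound on [E^2] holds with a spare factor [3/4], a large enough
    constant propagates by induction, also at the critical rate where the gain
    equals 1.

    [G] need not be lower semicontinuous on the boundary of [K], so [U] may have
    no minimizer.  Its role is played by the limit [xb] of a minimizing sequence
    together with the limit of the values of [G] along that sequence.  The
    Hessians are only assumed to exist pointwise; their symmetry, which is needed
    to pass from quadratic forms to operator norms, follows from the Frechet
    differentiability of the gradient. *)

(** The constants of the statement are read off from this loop. A gain of at most 1 means
    [alpha * Ahalf <= (r - rho)^2], that is [r >= rho + sqrt (alpha * Ahalf)]; the descent
    inequality contributes [r^2 >= 1 - Jc * alpha]. At the step-size [alpha_star] these two lower
    bounds for [r] agree, so [z] is the square of the larger one. [Jc] is half of the decrease rate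
    per unit of [alpha] that the descent guarantees. The unspent half keeps [r^2] above the
    contraction coefficient of [P] by a multiple of [alpha]; the disturbance of [P] is proportional
    to [alpha] as well, so their ratio stays below [2 * GPbar] for every admissible step-size. The
    bound [abar] keeps the curvature gained in the descent above [mutmin / 2]; at this worst value
    [Jc] is evaluated and, unless [mutmin = Dlmin], also [GPbar]. *)

(** * Euclidean inner product and norm on row vectors *)

Section Euclid.
Variables (R : realType) (d : nat).
Implicit Types (u v w : 'rV[R]_d) (a b : R).

Lemma dotpE u v : dotp u v = \sum_k u 0 k * v 0 k.
Proof. by rewrite /dotp mxE; apply: eq_bigr => k _; rewrite mxE. Qed.

Lemma dotpC u v : dotp u v = dotp v u.
Proof. by rewrite !dotpE; apply: eq_bigr => k _; rewrite mulrC. Qed.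

Lemma dotpDl u v w : dotp (u + v) w = dotp u w + dotp v w.
Proof. by rewrite /dotp mulmxDl mxE. Qed.

Lemma dotpDr u v w : dotp w (u + v) = dotp w u + dotp w v.
Proof. by rewrite dotpC dotpDl !(dotpC w). Qed.

Lemma dotpZl a u v : dotp (a *: u) v = a * dotp u v.
Proof. by rewrite /dotp -scalemxAl mxE. Qed.

Lemma dotpZr a u v : dotp u (a *: v) = a * dotp u v.
Proof. by rewrite dotpC dotpZl dotpC. Qed.

Lemma dotpNl u v : dotp (- u) v = - dotp u v.
Proof. by rewrite -scaleN1r dotpZl mulN1r. Qed.

Lemma dotpNr u v : dotp u (- v) = - dotp u v.
Proof. by rewrite -scaleN1r dotpZr mulN1r. Qed.

Lemma dotpBl u v w : dotp (u - v) w = dotp u w - dotp v w.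
Proof. by rewrite dotpDl dotpNl. Qed.

Lemma dotpBr u v w : dotp w (u - v) = dotp w u - dotp w v.
Proof. by rewrite dotpDr dotpNr. Qed.

Lemma dot0p u : dotp 0 u = 0.
Proof. by rewrite -(scale0r u) dotpZl mul0r. Qed.

Lemma dotp_suml n (F : 'I_n -> 'rV[R]_d) u :
  dotp (\sum_i F i) u = \sum_i dotp (F i) u.
Proof. by rewrite /dotp mulmx_suml summxE. Qed.

Lemma dotp_ebase u k : dotp u (ebase R k) = u 0 k.
Proof.
rewrite dotpE (bigD1 k) //= big1 ?addr0; first by rewrite mxE !eqxx mulr1.
by move=> j jk; rewrite mxE (negPf jk) andbF mulr0.
Qed.

Lemma dotpp_ge0 u : 0 <= dotp u u.
Proof. by rewrite dotpE sumr_ge0 // => k _; rewrite -expr2 sqr_ge0. Qed.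

Lemma dotpp_eq0 u : (dotp u u == 0) = (u == 0).
Proof.
apply/idP/eqP => [|->]; last by rewrite dot0p.
rewrite dotpE psumr_eq0; last by move=> k _; rewrite -expr2 sqr_ge0.
move=> /allP u0; apply/rowP => k; rewrite mxE.
by have := u0 k (mem_index_enum _); rewrite /= mulf_eq0 orbb => /eqP.
Qed.

Lemma enorm_ge0 u : 0 <= enorm u.
Proof. exact: sqrtr_ge0. Qed.

Lemma sqr_enorm u : enorm u ^+ 2 = dotp u u.
Proof. by rewrite sqr_sqrtr ?dotpp_ge0. Qed.

Lemma enorm_eq0 u : (enorm u == 0) = (u == 0).
Proof. by rewrite -dotpp_eq0 -sqr_enorm expf_eq0. Qed.

Lemma enormZ a u : enorm (a *: u) = `|a| * enorm u.
Proof.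
by rewrite /enorm dotpZl dotpZr mulrA -expr2 sqrtrM ?sqr_ge0 // sqrtr_sqr.
Qed.

Lemma enormN u : enorm (- u) = enorm u.
Proof. by rewrite -scaleN1r enormZ normrN1 mul1r. Qed.

Lemma enormB u v : enorm (u - v) = enorm (v - u).
Proof. by rewrite -enormN opprB. Qed.

Lemma enorm0 : enorm (0 : 'rV[R]_d) = 0.
Proof. by apply/eqP; rewrite enorm_eq0. Qed.

(** Cauchy-Schwarz, by expanding the square of [enorm v *: u - enorm u *: v]. *)
Lemma dotp_le_enorm u v : dotp u v <= enorm u * enorm v.
Proof.
have [/eqP u0|u0] := boolP (enorm u == 0).
  by move/eqP: u0; rewrite enorm_eq0 => /eqP ->; rewrite dot0p enorm0 mul0r.
have [/eqP v0|v0] := boolP (enorm v == 0).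
  by move/eqP: v0; rewrite enorm_eq0 => /eqP ->; rewrite dotpC dot0p enorm0 mulr0.
have up : 0 < enorm u by rewrite lt_def u0 enorm_ge0.
have vp : 0 < enorm v by rewrite lt_def v0 enorm_ge0.
have := dotpp_ge0 (enorm v *: u - enorm u *: v).
rewrite dotpBl !dotpBr !dotpZl !dotpZr -!sqr_enorm (dotpC v u) => h.
rewrite -(ler_pM2l (mulr_gt0 up vp)).
rewrite -subr_ge0; nra.
Qed.

Lemma ler_enormD u v : enorm (u + v) <= enorm u + enorm v.
Proof.
rewrite -(@ler_pXn2r _ 2) ?nnegrE ?addr_ge0 ?enorm_ge0 //.
rewrite sqr_enorm dotpDl !dotpDr (dotpC v u) sqrrD !sqr_enorm.
have := dotp_le_enorm u v; lra.
Qed.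

Lemma ler_enormB u v : enorm (u - v) <= enorm u + enorm v.
Proof. by rewrite -(enormN v) ler_enormD. Qed.

(** The topology of row vectors comes from the maximum norm; this comparison turns Euclidean
    estimates into convergence and boundedness. *)
Lemma mx_norm_le_enorm u : `|u| <= enorm u.
Proof.
rewrite /Num.norm /= mx_normrE; apply/bigmax_leP; split; first exact: enorm_ge0.
move=> [i k] _ /=; rewrite -(@ler_pXn2r _ 2) ?nnegrE ?enorm_ge0 //.
rewrite sqr_enorm dotpE (bigD1 k) //= ord1 real_normK ?num_real // expr2 lerDl.
by rewrite sumr_ge0 // => j _; rewrite -expr2 sqr_ge0.
Qed.

End Euclid.

(** * Continuity of the inner product and of the norm *)

Section Continuity.
Variables (R : realType) (d : nat).

Lemma continuous_dotpl (v : 'rV[R]_d) : continuous (fun u : 'rV[R]_d => dotp u v).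
Proof.
under eq_fun do rewrite dotpE.
apply: (@continuous_big _ _ _ _ _ _ 'rV[R]_d) => [|i _ x]; first exact: add_continuous.
have h := @coord_continuous R 1 d 0 i x.
apply: (@cvgM R _ (nbhs x) _ (fun u : 'rV[R]_d => u 0 i) (fun=> v 0 i)) => //.
exact: cvg_cst.
Qed.

Lemma continuous_enorm : continuous (@enorm R d).
Proof.
move=> x; apply: (@continuous_comp _ _ _ (fun u : 'rV[R]_d => dotp u u) Num.sqrt);
  last exact: sqrt_continuous.
apply: (_ : continuous _) x; under eq_fun do rewrite dotpE.
apply: (@continuous_big _ _ _ _ _ _ 'rV[R]_d) => [|i _ x]; first exact: add_continuous.
have h := @coord_continuous R 1 d 0 i x.
exact: (@cvgM R _ (nbhs x) _ (fun u : 'rV[R]_d => u 0 i) (fun u : 'rV[R]_d => u 0 i)).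
Qed.

End Continuity.

(** * One-variable calculus along lines *)

Section OneVariable.
Variable R : realType.

Lemma is_derive_line (V : normedModType R) (f : V -> R) (x v : V) (t l : R) :
  is_derive (x + t *: v) v f l -> is_derive t 1 (fun s => f (x + s *: v)) l.
Proof.
have E : (fun h : R => h^-1 *: (((fun s => f (x + s *: v)) \o shift t) (h *: 1) -
    f (x + t *: v))) =
  (fun h => h^-1 *: ((f \o shift (x + t *: v)) (h *: v) - f (x + t *: v))).
  apply/funext => h /=; congr (_ *: (f _ - _)).
  by rewrite -[h *: 1]/(h * 1) mulr1 scalerDl addrCA addrA.
by case=> fd fl; apply: DeriveDef; rewrite /derivable /derive E.
Qed.

(** Divide by [t] and let [t] tend to 0 from the right. The term in [t ^+ 2] vanishes in the limit,
    which leaves room for strong convexity. *)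
Lemma slope_le (phi : R -> R) (l c e : R) : is_derive (0 : R) 1 phi l ->
  (forall t, 0 < t <= 1 -> phi t - phi 0 <= t * c + t ^+ 2 * e) -> l <= c.
Proof.
move=> [phid <-] phile.
have cl : (fun h : R => h^-1 *: (phi h - phi 0)) @ at_right 0 --> 'D_1 phi 0.
  have E : (fun h : R => h^-1 *: ((phi \o shift 0) (h *: 1) - phi 0)) =
      (fun h => h^-1 *: (phi h - phi 0)).
    by apply/funext => h; rewrite /= addr0 -[h *: _]/(h * _) mulr1.
  have := phid; rewrite /derivable /derive !E => h.
  by apply: cvg_dnbhs_at_right; exact: h.
have cr : (fun h : R => c + h * e) @ at_right 0 --> c + 0 * e.
  apply: cvg_at_right_filter; apply: cvgD; first exact: cvg_cst.
  by apply: cvgMl; exact: cvg_id.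
suff H : \forall h \near at_right (0 : R), h^-1 *: (phi h - phi 0) <= c + h * e.
  have := ler_cvg_to cl cr H; rewrite mul0r addr0; apply.
near=> h.
have h0 : 0 < h by [].
rewrite -[_ *: _]/(_ * _) mulrC ler_pdivrMr //.
have -> : (c + h * e) * h = h * c + h ^+ 2 * e by ring.
apply: phile; rewrite h0 /=.
by near: h; exact: nbhs_right_le.
Unshelve. all: by end_near. Qed.

(** The case [a = b] is included because a mean value point, possibly 0, later serves as an end
    point. *)
Lemma mean_value (phi dphi : R -> R) (a b : R) : a <= b ->
  (forall t, a <= t <= b -> is_derive t 1 phi (dphi t)) ->
  exists2 c, a <= c <= b & phi b - phi a = dphi c * (b - a).
Proof.
move=> ab phid.
have [||c cab E] := @MVT_segment R phi dphi a b ab.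
- by move=> x xab; apply: phid; rewrite !(itvP xab).
- apply: derivable_within_continuous => x xab.
  by have [] := phid x; rewrite ?(itvP xab).
- by exists c => //; rewrite !(itvP cab).
Qed.

Lemma is_derive_quadratic (t c e : R) :
  is_derive t 1 (fun s : R => s * c + s ^+ 2 * e) (c + 2 * t * e).
Proof.
have H1 : is_derive t 1 (fun s : R => s * c) c.
  have -> : (fun s : R => s * c) = c *: (id : R -> R).
    by apply/funext => s; rewrite /= mulrC.
  by apply: is_derive_eq; rewrite [LHS]mulr1.
have H2 : is_derive t 1 (fun s : R => s ^+ 2 * e) (2 * t * e).
  have -> : (fun s : R => s ^+ 2 * e) = e *: ((id : R -> R) ^+ 2).
    by apply/funext => s; rewrite /= mulrC.
  apply: is_derive_eq; rewrite -![_ *: _]/(_ * _) /=; ring.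
exact: (@is_deriveD _ _ _ (fun s : R => s * c) (fun s : R => s ^+ 2 * e)).
Qed.

End OneVariable.

(** * Consequences of Hessian bounds on a convex set *)

Section SecondOrder.
Variables (R : realType) (d : nat).
Notation V := 'rV[R]_d.
Implicit Types (A K O : set V) (h : V -> R) (g : V -> V) (H : V -> 'M[R]_d).

(* The directional derivatives of [h] and of its gradient field [g] along [A];
   differentiability in the Frechet sense is not retained, since only the
   restrictions to segments matter once the Hessian is known to be symmetric. *)
Definition second_order A h g H := forall x, A x ->
  [/\ forall v, is_derive x v h (dotp (g x) v),
      forall v w, is_derive x v (fun y => dotp (g y) w) (dotp (v *m H x) w)
    & forall u v, dotp (u *m H x) v = dotp (v *m H x) u].

Lemma second_order_sub A K h g H : K `<=` A ->
  second_order A h g H -> second_order K h g H.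
Proof. by move=> KA hg x /KA; exact: hg. Qed.

Lemma second_orderB A h g H h' g' H' :
  second_order A h g H -> second_order A h' g' H' ->
  second_order A (fun x => h x - h' x) (fun x => g x - g' x)
    (fun x => H x - H' x).
Proof.
move=> hg hg' x Ax; have [h1 h2 h3] := hg x Ax; have [h1' h2' h3'] := hg' x Ax.
split=> [v|v w|u v].
- rewrite dotpBl; exact: (@is_deriveB _ _ _ h h').
- rewrite mulmxBr dotpBl.
  have -> : (fun y => dotp (g y - g' y) w) =
    (fun y => dotp (g y) w) - (fun y => dotp (g' y) w).
    by apply/funext => y; rewrite dotpBl.
  exact: is_deriveB.
- by rewrite !mulmxBr !dotpBl h3 h3'.
Qed.

Lemma second_order_mean A (m : nat) (h : 'I_m -> V -> R) (G : 'I_m -> V -> V)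
    (H : 'I_m -> V -> 'M[R]_d) :
  (forall i, second_order A (h i) (G i) (H i)) ->
  second_order A (avgF h) (fun x => m%:R^-1 *: \sum_i G i x)
    (fun x => m%:R^-1 *: \sum_i H i x).
Proof.
move=> hg x Ax; split=> [v|v w|u v].
- have -> : avgF h = m%:R^-1 *: \sum_i h i.
    by apply/funext => y; rewrite /avgF; congr (_ * _); rewrite fct_sumE.
  rewrite dotpZl dotp_suml.
  have h1 i : is_derive x v (h i) (dotp (G i x) v) by have [] := hg i x Ax.
  exact: is_deriveZ.
- have -> : (fun y => dotp (m%:R^-1 *: \sum_i G i y) w) =
      m%:R^-1 *: \sum_i (fun y => dotp (G i y) w).
    by apply/funext => y; rewrite dotpZl dotp_suml; congr (_ * _); rewrite fct_sumE.
  rewrite -scalemxAr mulmx_sumr dotpZl dotp_suml.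
  have h1 i : is_derive x v (fun y => dotp (G i y) w) (dotp (v *m H i x) w).
    by have [] := hg i x Ax.
  exact: is_deriveZ.
- rewrite -!scalemxAr !mulmx_sumr !dotpZl !dotp_suml; congr (_ * _).
  by apply: eq_bigr => i _; have [] := hg i x Ax.
Qed.

Lemma segment_mem K (x z : V) (t : R) : convex_setR K -> K x -> K z ->
  0 <= t <= 1 -> K (x + t *: (z - x)).
Proof.
move=> cK Kx Kz t01; have := cK x z t Kx Kz t01.
by rewrite scalerBl scale1r scalerBr addrA addrAC.
Qed.

Lemma second_order_line K h g H (x z : V) : convex_setR K ->
  second_order K h g H -> K x -> K z -> forall t : R, 0 <= t <= 1 -> forall w,
  is_derive t 1 (fun s : R => dotp (g (x + s *: (z - x))) w)
    (dotp ((z - x) *m H (x + t *: (z - x))) w).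
Proof.
move=> cK hg Kx Kz t t01 w.
have [_ h2 _] := hg _ (segment_mem cK Kx Kz t01).
exact: (is_derive_line (f := fun y => dotp (g y) w)).
Qed.

(** Two mean value steps replace an integral remainder, so no continuity of the Hessian enters: one
    for [h] minus its quadratic model on [0, 1], giving a point [c], and one for the directional
    derivative on [0, [c]]. The number [a] may be negative. *)
Lemma taylor_lower_bound K h g H (a : R) : convex_setR K ->
  second_order K h g H ->
  (forall z, K z -> forall u, a * dotp u u <= dotp (u *m H z) u) ->
  forall x z, K x -> K z ->
  h x + dotp (g x) (z - x) + a / 2 * dotp (z - x) (z - x) <= h z.
Proof.
move=> cK hg Ha x z Kx Kz; set v := z - x.
pose q s : R := s * - dotp (g x) v + s ^+ 2 * (- (a / 2) * dotp v v).
pose psi s := h (x + s *: v) + q s.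
have psid (t : R) : 0 <= t <= 1 -> is_derive t 1 psi
    (dotp (g (x + t *: v)) v + (- dotp (g x) v + 2 * t * (- (a / 2) * dotp v v))).
  move=> t01; have [h1 _ _] := hg _ (segment_mem cK Kx Kz t01).
  have Hl := is_derive_line (h1 v).
  have Hq := is_derive_quadratic t (- dotp (g x) v) (- (a / 2) * dotp v v).
  exact: (is_deriveD Hl Hq).
have [c c01 Ec] := mean_value ler01 psid.
have [e /andP[e0 ec] Ee] := @mean_value R (fun s => dotp (g (x + s *: v)) v) _ 0 c
  (andP c01).1 (fun t t01 => second_order_line cK hg Kx Kz
    (introT andP (conj (andP t01).1 (le_trans (andP t01).2 (andP c01).2))) v).
have e01 : 0 <= e <= 1 by rewrite e0 (le_trans ec) //; case/andP: c01.
have := Ha _ (segment_mem cK Kx Kz e01) v.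
move: Ec Ee; rewrite /psi /q scale1r scale0r addr0 subr0 mulr1 /v subrKC.
set k := dotp (_ *m _) _; move=> Ec Ee ak.
have c0 : 0 <= c by case/andP: c01.
have : 0 <= c * (k - a * dotp (z - x) (z - x)) by rewrite mulr_ge0 // subr_ge0.
lra.
Qed.

(** The mean value theorem is scalar, so it is applied to the component of the gradient along
    [w = g z - g x]; then a factor [enorm w] is cancelled. *)
Lemma gradient_lipschitz K h g H (D : R) : 0 <= D -> convex_setR K ->
  second_order K h g H ->
  (forall z, K z -> forall u v, dotp (u *m H z) v <= D * (enorm u * enorm v)) ->
  forall x z, K x -> K z -> enorm (g z - g x) <= D * enorm (z - x).
Proof.
move=> D0 cK hg HD x z Kx Kz; set w := g z - g x.
have [c c01 Ec] := mean_value ler01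
  (fun t t01 => second_order_line cK hg Kx Kz t01 w).
have [->|w0] := eqVneq w 0.
  by rewrite enorm0 mulr_ge0 ?enorm_ge0.
have wp : 0 < enorm w by rewrite lt_def enorm_eq0 w0 enorm_ge0.
rewrite -(ler_pM2r wp) -expr2 sqr_enorm {1}/w dotpBl -mulrA.
apply: le_trans (HD _ (segment_mem cK Kx Kz c01) _ _).
by move: Ec; rewrite scale1r scale0r addr0 subrKC subr0 mulr1 => ->.
Qed.

End SecondOrder.

(** * Gradients and Hessians of twice differentiable functions; symmetry *)

Section Hessian.
Variables (R : realType) (d : nat).
Notation V := 'rV[R]_d.
Implicit Types (A K O : set V) (f : V -> R).

Lemma derive_grad f (x v : V) : differentiable f x ->
  is_derive x v f (dotp (grad f x) v).
Proof.
move=> fx; apply: DeriveDef; first exact: diff_derivable.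
rewrite deriveE // {1}(row_sum_delta v) linear_sum dotpE.
apply: eq_bigr => k _; rewrite linearZ mxE -deriveE //.
by rewrite -[LHS]/(_ * _) mulrC.
Qed.

Lemma derive_grad_hess f (x v w : V) :
  (forall j, differentiable (fun y => derive f y (ebase R j)) x) ->
  is_derive x v (fun y => dotp (grad f y) w) (dotp (v *m hess f x) w).
Proof.
move=> fx.
have E : (fun y => dotp (grad f y) w) =
    \sum_j w 0 j *: (fun y => derive f y (ebase R j)).
  apply/funext => y; rewrite dotpE fct_sumE; apply: eq_bigr => j _.
  by rewrite mxE mulrC.
have H j : is_derive x v (fun y => derive f y (ebase R j)) ((v *m hess f x) 0 j).
  suff -> : (v *m hess f x) 0 j =
      dotp (grad (fun y => derive f y (ebase R j)) x) v by exact: derive_grad.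
  by rewrite dotpE !mxE; apply: eq_bigr => i _; rewrite !mxE mulrC.
rewrite E; apply: is_derive_eq; rewrite dotpE; apply: eq_bigr => j _.
by rewrite -[LHS]/(_ * _) mulrC.
Qed.

Lemma differentiable_grad f (x w : V) :
  (forall j, differentiable (fun y => derive f y (ebase R j)) x) ->
  differentiable (fun y => dotp (grad f y) w) x.
Proof.
move=> fx.
have -> : (fun y => dotp (grad f y) w) =
    \sum_j w 0 j *: (fun y => derive f y (ebase R j)).
  apply/funext => y; rewrite dotpE fct_sumE; apply: eq_bigr => j _.
  by rewrite mxE mulrC.
by apply: differentiable_sum => j; exact: differentiableZ.
Qed.

Lemma differentiable_remainder (k : V -> R) (x : V) (e : R) :
  0 < e -> differentiable k x ->
  exists2 r : R, 0 < r & forall h, `|h| < r ->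
    `|k (x + h) - k x - 'D_h k x| <= e * `|h|.
Proof.
move=> e0 kx; have := diff_locallyx kx.
set o := 'o_ _ _ => E.
have /(littleoP [littleo of o]) /nbhs_ballP[r r0 Hr] := e0.
exists r => // h hr; rewrite (addrC x) E deriveE //.
have -> : k x + 'd k x h + o h - k x - 'd k x h = o h by ring.
by apply: Hr; rewrite -ball_normE /= sub0r normrN.
Qed.

(** Alternating sum of [f] over the corners of the parallelogram at [x] with sides [t u] and [t v];
    its invariance under exchanging [u] and [v] is the source of the symmetry of the Hessian. *)
Definition second_difference f (x u v : V) (t : R) :=
  f (x + t *: v + t *: u) - f (x + t *: u) - (f (x + t *: v) - f x).

Lemma second_differenceC f (x u v : V) (t : R) :
  second_difference f x u v t = second_difference f x v u t.
Proof. by rewrite /second_difference (addrAC x); ring. Qed.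

(** The mean value theorem in the direction [u] turns the second difference into [t] times a
    difference of [k], the derivative of [f] along [u], at two points near [x]. Differentiability of
    [k] at the single point [x] then expands both values up to [o(t)]. *)
Lemma second_difference_hess O f (x u v : V) (e : R) : open O -> O x ->
  twice_diff_fun_on O f -> 0 < e ->
  \forall t \near at_right (0 : R),
    `|second_difference f x u v t - t ^+ 2 * dotp (v *m hess f x) u|
      <= t ^+ 2 * (2 * e * (`|u| + `|v|)).
Proof.
move=> oO Ox f2 e0; set k := fun y => dotp (grad f y) u.
have kx : differentiable k x by apply: differentiable_grad; case: (f2 x Ox).
have Dk : forall h, 'D_h k x = dotp (h *m hess f x) u.
  by move=> h; have /(_ h u)[] := derive_grad_hess _ _ (f2 x Ox).2.
have [r r0 Hr] := differentiable_remainder e0 kx.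
have /nbhs_ballP[r' r'0 Hr'] := oO _ Ox.
set M := `|u| + `|v|; have M0 : 0 <= M by rewrite addr_ge0.
near=> t.
have t0 : 0 < t by [].
have tM : t * (M + 1) < Num.min r r'.
  rewrite -ltr_pdivlMr ?ltr_wpDl //; near: t; apply: nbhs_right_lt.
  by rewrite divr_gt0 ?ltr_wpDl // lt_min r0.
have small (a c : R) : 0 <= a <= t -> 0 <= c <= t -> `|a *: v + c *: u| <= t * M.
  move=> /andP[a0 at_] /andP[c0 ct]; apply: le_trans (ler_normD _ _) _.
  rewrite !normrZ !ger0_norm // /M mulrDr addrC.
  by rewrite lerD // ler_wpM2r.
have tMr : t * M < r /\ t * M < r'.
  have : t * M < Num.min r r'.
    by apply: le_lt_trans tM; rewrite ler_pM2l // lerDl.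
  by rewrite lt_min => /andP.
have Oin (a c : R) : 0 <= a <= t -> 0 <= c <= t -> O (x + a *: v + c *: u).
  move=> at_ ct; apply: Hr'; rewrite -ball_normE /= -addrA opprD addNKr normrN.
  exact: le_lt_trans (small _ _ at_ ct) tMr.2.
have tt : 0 <= t <= t by rewrite lexx ltW.
have zt : 0 <= (0 : R) <= t by rewrite lexx ltW.
pose phi s := f (x + t *: v + s *: u) - f (x + s *: u).
have phid (s : R) : 0 <= s <= t ->
    is_derive s 1 phi (k (x + t *: v + s *: u) - k (x + s *: u)).
  move=> st.
  have O1 := Oin _ _ tt st.
  have O2 : O (x + s *: u) by have := Oin _ _ zt st; rewrite scale0r addr0.
  have H1 := is_derive_line (derive_grad u (f2 _ O1).1).
  have H2 := is_derive_line (derive_grad u (f2 _ O2).1).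
  exact: (is_deriveB H1 H2).
have [c ct Ec] := mean_value (ltW t0) phid.
have Edif : second_difference f x u v t =
    (k (x + t *: v + c *: u) - k (x + c *: u)) * t.
  by move: Ec; rewrite /second_difference /phi scale0r !addr0 subr0.
have tr := tMr.1.
have R1 := Hr _ (le_lt_trans (small _ _ tt ct) tr).
have R2 : `|k (x + c *: u) - k x - 'D_(c *: u) k x| <= e * `|c *: u|.
  apply: Hr; have := small 0 c zt ct; rewrite scale0r add0r => /le_lt_trans; exact.
have S1 := small _ _ tt ct.
have S2 : `|c *: u| <= t * M by have := small 0 c zt ct; rewrite scale0r add0r.
move: R1 R2; rewrite !Dk mulmxDl dotpDl -!scalemxAl !dotpZl addrA => R1 R2.
rewrite Edif.
have B1 : e * `|t *: v + c *: u| <= e * (t * M) by rewrite ler_pM2l.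
have B2 : e * `|c *: u| <= e * (t * M) by rewrite ler_pM2l.
have := le_trans R1 B1; have := le_trans R2 B2.
rewrite !ler_norml => /andP[L2 U2] /andP[L1 U1].
set q := dotp (v *m _) u in L1 U1 *.
set p1 := k (x + t *: v + c *: u) in L1 U1 *.
set p2 := k (x + c *: u) in L1 U1 L2 U2 *.
have T1 : p1 - p2 - t * q <= 2 * e * (t * M) by lra.
have T2 : - (2 * e * (t * M)) <= p1 - p2 - t * q by lra.
have -> : (p1 - p2) * t - t ^+ 2 * q = t * (p1 - p2 - t * q) by ring.
have -> : t ^+ 2 * (2 * e * M) = t * (2 * e * (t * M)) by ring.
by rewrite -mulrN !ler_pM2l // T1 T2.
Unshelve. all: by end_near. Qed.

(** Both forms are the limit of the same second difference divided by [t ^+ 2]. *)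
Lemma hess_sym O f (x u v : V) : open O -> O x -> twice_diff_fun_on O f ->
  dotp (u *m hess f x) v = dotp (v *m hess f x) u.
Proof.
move=> oO Ox f2; set p := dotp (u *m _) v; set q := dotp (v *m _) u.
apply/eqP; rewrite -subr_eq0 -normr_le0; apply/ler_addgt0Pl => e e0.
rewrite addr0; set M := `|u| + `|v| + 1.
have M0 : 0 < M by rewrite ltr_wpDl // addr_ge0.
(* With this accuracy each of the two errors is at most [t ^+ 2 * (e / 2)]. *)
have e'0 : 0 < e / (4 * M) by rewrite divr_gt0 // mulr_gt0.
near (0 : R)^'+ => t.
have t0 : 0 < t by [].
have H1 : `|second_difference f x u v t - t ^+ 2 * q|
    <= t ^+ 2 * (2 * (e / (4 * M)) * (`|u| + `|v|)).
  near: t; exact: second_difference_hess oO Ox f2 e'0.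
have H2 : `|second_difference f x v u t - t ^+ 2 * p|
    <= t ^+ 2 * (2 * (e / (4 * M)) * (`|v| + `|u|)).
  near: t; exact: second_difference_hess oO Ox f2 e'0.
rewrite second_differenceC (addrC `|v|) in H2.
have B : 2 * (e / (4 * M)) * (`|u| + `|v|) <= e / 2.
  have -> : e / 2 = 2 * (e / (4 * M)) * M.
    by field; rewrite gt_eqF.
  by apply: ler_wpM2l; [rewrite mulr_ge0 ?ltW|rewrite /M lerDl].
have t2 : 0 < t ^+ 2 by rewrite exprn_gt0.
have B' : t ^+ 2 * (2 * (e / (4 * M)) * (`|u| + `|v|)) <= t ^+ 2 * (e / 2).
  by rewrite ler_pM2l.
have := le_trans H1 B'; have := le_trans H2 B'.
rewrite !ler_norml => /andP[L2 U2] /andP[L1 U1].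
by apply/andP; split; rewrite -(ler_pM2l t2); lra.
Unshelve. all: by end_near. Qed.

Lemma second_order_twice_diff O f : open O -> twice_diff_fun_on O f ->
  second_order O f (grad f) (hess f).
Proof.
move=> oO f2 x Ox; split=> [v|v w|u v].
- exact/derive_grad/(f2 x Ox).1.
- exact/derive_grad_hess/(f2 x Ox).2.
- exact: hess_sym oO Ox f2.
Qed.

(** The assumptions speak of [hess (avgF f)], the differentiation rules produce the average of the
    Hessians. Openness makes the two gradients agree near [x], hence also their derivatives. *)
Lemma second_order_unique O f g H : open O -> second_order O f g H ->
  forall x, O x -> grad f x = g x /\ hess f x = H x.
Proof.
move=> oO fg.
have E x : O x -> grad f x = g x.
  move=> Ox; have [h1 _ _] := fg x Ox; apply/rowP => j.
  by rewrite mxE -[RHS]dotp_ebase; have [] := h1 (ebase R j).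
move=> x Ox; split; first exact: E.
have [_ h2 _] := fg x Ox; apply/matrixP => i j; rewrite mxE.
have := h2 (ebase R i) (ebase R j).
have -> : dotp (ebase R i *m H x) (ebase R j) = H x i j.
  by rewrite dotp_ebase -rowE mxE.
move=> [_ <-]; apply: near_eq_derive.
have : nbhs x O by exact: oO.
apply: filterS => y Oy /=; rewrite -E // dotp_ebase mxE //.
Qed.

(** [O] need not be convex, so by homogeneity [v] is shortened until the segment lies in a ball
    inside [O]. There the gradient inequality, used in both directions, shows that the derivative
    along [v] is monotone. *)
Lemma hess_psd O f (x v : V) : open O -> O x -> twice_diff_fun_on O f ->
  convex_fun_on O f -> 0 <= dotp (v *m hess f x) v.
Proof.
move=> oO Ox f2 fc.
have /nbhs_ballP[r r0 Hr] := oO _ Ox.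
have fg := second_order_twice_diff oO f2.
wlog vr : v / `|v| < r => [W|].
  set c := r / 2 / (`|v| + 1).
  have v1 : 0 < `|v| + 1 by rewrite ltr_wpDl.
  have c0 : 0 < c by rewrite !divr_gt0.
  have : 0 <= dotp ((c *: v) *m hess f x) (c *: v).
    apply: W; rewrite normrZ gtr0_norm //.
    have E : c * (`|v| + 1) = r / 2 by rewrite /c divfK ?gt_eqF.
    apply: (@le_lt_trans _ _ (r / 2)); last by rewrite gtr_pMr // invf_lt1 // ltr1n.
    by rewrite -E mulrDr mulr1 lerDl ltW.
  by rewrite -scalemxAl dotpZl dotpZr !pmulr_rge0.
have Oin (t : R) : 0 <= t <= 1 -> O (x + t *: v).
  move=> /andP[t0 t1]; apply: Hr.
  rewrite -ball_normE /= opprD addNKr normrN normrZ ger0_norm //.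
  by apply: le_lt_trans vr; rewrite ler_piMl.
have gi (p q : R) : 0 <= p <= 1 -> 0 <= q <= 1 ->
    dotp (grad f (x + p *: v)) ((q - p) *: v) <= f (x + q *: v) - f (x + p *: v).
  move=> p01 q01; have [h1 _ _] := fg _ (Oin _ p01).
  have Hl := h1 ((q - p) *: v).
  rewrite -{1}[x + p *: v]addr0 -{1}(scale0r ((q - p) *: v)) in Hl.
  apply: (slope_le (is_derive_line Hl) (e := 0)) => t /andP[t0 t1].
  rewrite scale0r addr0 mulr0 addr0.
  have t01 : 0 <= t <= 1 by rewrite ltW.
  have E : x + p *: v + t *: ((q - p) *: v) =
      (1 - t) *: (x + p *: v) + t *: (x + q *: v).
    by apply/rowP => j; rewrite !mxE; ring.
  have E' : x + p *: v + t *: ((q - p) *: v) = x + (p + t * (q - p)) *: v.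
    by apply/rowP => j; rewrite !mxE; ring.
  have Ot : O (x + p *: v + t *: ((q - p) *: v)).
    rewrite E'; apply: Oin; move: p01 q01 => /andP[p0 p1] /andP[q0 q1].
    have a1 : 0 <= (1 - t) * p by rewrite mulr_ge0 // subr_ge0.
    have a2 : 0 <= t * q by rewrite mulr_ge0 // ltW.
    have a3 : 0 <= (1 - t) * (1 - p) by rewrite mulr_ge0 // subr_ge0.
    have a4 : 0 <= t * (1 - q) by rewrite mulr_ge0 ?subr_ge0 // ltW.
    by apply/andP; split; lra.
  rewrite E; have := fc _ _ t (Oin _ p01) (Oin _ q01) t01; rewrite -E => /(_ Ot).
  lra.
have [_ h2 _] := fg _ Ox.
have Hl := h2 v v; rewrite -{1}[x]addr0 -{1}(scale0r v) in Hl.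
have Hl' := is_deriveN (is_derive_line Hl).
rewrite -oppr_le0; apply: (slope_le Hl' (e := 0)) => t /andP[t0 t1].
have t01 : 0 <= t <= 1 by rewrite ltW.
have z01 : 0 <= (0 : R) <= 1 by rewrite lexx ler01.
have := gi _ _ z01 t01; have := gi _ _ t01 z01.
rewrite !dotpZr; rewrite -[(- _) t]/(- _) -[(- _) 0]/(- _) => i1 i2.
rewrite -(ler_pM2l t0); lra.
Qed.

End Hessian.

(** * Convexity inequalities, optimality conditions and the generalized minimizer *)

Section Convexity.
Variables (R : realType) (d : nat).
Notation V := 'rV[R]_d.
Implicit Types (K : set V) (F G : V -> R) (g : V -> V).

(** Polarization with [a = enorm v *: u] and [b = enorm u *: v]: equal lengths make the
    parallelogram identity yield exactly the constant [D]. *)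
Lemma symmetric_form_bound (M : 'M[R]_d) (D : R) :
  (forall u v, dotp (u *m M) v = dotp (v *m M) u) ->
  (forall u, `|dotp (u *m M) u| <= D * dotp u u) ->
  forall u v, dotp (u *m M) v <= D * (enorm u * enorm v).
Proof.
move=> sM MD u v.
have [->|u0] := eqVneq u 0; first by rewrite mul0mx dot0p enorm0 mul0r mulr0.
have [->|v0] := eqVneq v 0.
  by rewrite dotpC dot0p enorm0 !mulr0.
have up : 0 < enorm u by rewrite lt_def enorm_eq0 u0 enorm_ge0.
have vp : 0 < enorm v by rewrite lt_def enorm_eq0 v0 enorm_ge0.
set a := enorm v *: u; set b := enorm u *: v.
have := MD (a + b); have := MD (a - b).
rewrite !ler_norml => /andP[h1 _] /andP[_ h2].
have h : dotp (a *m M) b <= D * (enorm u ^+ 2 * enorm v ^+ 2).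
  move: h1 h2; rewrite mulmxBl mulmxDl !(dotpDl, dotpDr, dotpBl, dotpBr, dotpNl, dotpNr).
  rewrite (sM b a) (dotpC b a) /a /b !dotpZl !dotpZr -!sqr_enorm.
  lra.
move: h; rewrite /a /b -scalemxAl dotpZl dotpZr => h.
by rewrite -(ler_pM2l up) -(ler_pM2l vp); lra.
Qed.

Lemma strongly_convex_lower_bound K F (mu : R) (g x z : V) : convex_setR K ->
  strongly_convex_fun_on K mu F -> (forall v, is_derive x v F (dotp g v)) ->
  K x -> K z ->
  F x + dotp g (z - x) + mu / 2 * dotp (z - x) (z - x) <= F z.
Proof.
move=> cK Fc Fg Kx Kz.
have Hl := Fg (z - x); rewrite -{1}[x]addr0 -{1}(scale0r (z - x)) in Hl.
suff : dotp g (z - x) <= F z - F x - mu / 2 * dotp (z - x) (z - x) by lra.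
apply: (slope_le (is_derive_line Hl) (e := mu / 2 * dotp (z - x) (z - x))).
move=> t /andP[t0 t1]; have t01 : 0 <= t <= 1 by rewrite ltW.
have E : x + t *: (z - x) = (1 - t) *: x + t *: z.
  by apply/rowP => j; rewrite !mxE; ring.
rewrite scale0r addr0 E; have := Fc x z t Kx Kz t01 (cK _ _ _ Kx Kz t01).
rewrite enormB sqr_enorm; lra.
Qed.

Lemma strongly_convex_monotone K F (mu : R) (gx gz x z : V) : convex_setR K ->
  strongly_convex_fun_on K mu F -> (forall v, is_derive x v F (dotp gx v)) ->
  (forall v, is_derive z v F (dotp gz v)) -> K x -> K z ->
  mu * dotp (z - x) (z - x) <= dotp (gz - gx) (z - x).
Proof.
move=> cK Fc Fx Fz Kx Kz.
have := strongly_convex_lower_bound cK Fc Fx Kx Kz.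
have := strongly_convex_lower_bound cK Fc Fz Kz Kx.
rewrite -(opprB z x) !dotpNr dotpNl (dotpBl gz); lra.
Qed.

Lemma second_order_strongly_convex K F g H (mu : R) : convex_setR K ->
  second_order K F g H ->
  (forall z, K z -> forall u, mu * dotp u u <= dotp (u *m H z) u) ->
  strongly_convex_fun_on K mu F.
Proof.
move=> cK Fg Fmu p q t Kp Kq t01 Kw; set w := (1 - t) *: p + t *: q.
have := taylor_lower_bound cK Fg Fmu Kw Kp.
have := taylor_lower_bound cK Fg Fmu Kw Kq.
have -> : q - w = - (1 - t) *: (p - q) by apply/rowP => j; rewrite !mxE; ring.
have -> : p - w = t *: (p - q) by apply/rowP => j; rewrite !mxE; ring.
rewrite !dotpZl !dotpZr sqr_enorm; set e := dotp (p - q) _.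
set l := dotp _ _; move: t01 => /andP[t0 t1] i1 i2.
have j1 := ler_wpM2l t0 i1.
have t1' : 0 <= 1 - t by rewrite subr_ge0.
have j2 := ler_wpM2l t1' i2.
lra.
Qed.

(* [c] plays the role of the value of [G] at [x]; it may be smaller than [G x]
   when [G] is not lower semicontinuous. *)
Lemma first_order_optimality F G (g x z : V) (c : R) :
  (forall v, is_derive x v F (dotp g v)) ->
  (forall t, 0 < t <= 1 ->
     F x + c <= F (x + t *: (z - x)) + ((1 - t) * c + t * G z)) ->
  0 <= dotp g (z - x) + G z - c.
Proof.
move=> Fg Fmin; have Hl := Fg (z - x).
rewrite -{1}[x]addr0 -{1}(scale0r (z - x)) in Hl.
have Hl' := is_deriveN (is_derive_line Hl).
suff : - dotp g (z - x) <= G z - c by lra.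
apply: (slope_le Hl' (e := 0)) => t t01.
rewrite -[(- _) t]/(- _) -[(- _) 0]/(- _) scale0r addr0.
have := Fmin t t01; lra.
Qed.

Lemma minimizer_variational_inequality K F G (g x : V) : convex_setR K ->
  convex_fun_on K G -> K x -> (forall v, is_derive x v F (dotp g v)) ->
  (forall z, K z -> F x + G x <= F z + G z) ->
  forall z, K z -> 0 <= dotp g (z - x) + G z - G x.
Proof.
move=> cK cG Kx Fg xmin z Kz; apply: (first_order_optimality Fg) => t /andP[t0 t1].
have t01 : 0 <= t <= 1 by rewrite ltW.
have E : x + t *: (z - x) = (1 - t) *: x + t *: z.
  by apply/rowP => j; rewrite !mxE; ring.
have Kw := cK _ _ _ Kx Kz t01.
rewrite E; apply: le_trans (xmin _ Kw) _.
by rewrite lerD2l cG.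
Qed.

(** [Gb] is the limit of [G] along the minimizing sequence. The last clause transfers any lower
    bound of [G] by an affine function to [xb] with [Gb] in place of [G xb]; it is how the
    optimality of an agent is later tested at [xb]. *)
Lemma generalized_minimizer K F G g H (mu : R) :
  K !=set0 -> closed K -> convex_setR K -> second_order K F g H ->
  (forall x, K x -> {for x, continuous F}) ->
  0 < mu -> (forall z, K z -> forall u, mu * dotp u u <= dotp (u *m H z) u) ->
  convex_fun_on K G -> has_lbound [set F z + G z | z in K] ->
  exists xb Gb, [/\ K xb,
    forall x, K x -> mu / 2 * dotp (x - xb) (x - xb) <=
      F x + G x - inf [set F z + G z | z in K],
    forall z, K z -> 0 <= dotp (g xb) (z - xb) + G z - Gb
  & forall a c, (forall z, K z -> 0 <= dotp a z + G z - c) ->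
      0 <= dotp a xb + Gb - c].
Proof.
move=> K0 clK cK Fg Fcont mu0 Fmu cG lbU.
set U := fun z => F z + G z; set Us := inf _.
have Fsc := second_order_strongly_convex cK Fg Fmu.
have Ule z : K z -> Us <= U z by move=> Kz; apply: ge_inf => //; exists z.
have midpoint p q t : K p -> K q -> 0 <= t <= 1 ->
    Us <= (1 - t) * U p + t * U q - mu / 2 * t * (1 - t) * enorm (p - q) ^+ 2.
  move=> Kp Kq t01; have Kw := cK _ _ _ Kp Kq t01.
  have := Ule _ Kw; have := Fsc _ _ _ Kp Kq t01 Kw; have := cG _ _ _ Kp Kq t01 Kw.
  by rewrite /U; lra.
have infU : has_inf [set F z + G z | z in K].
  by split => //; case: K0 => k Kk; exists (U k), k.
have /choice[z zP] (n : nat) : exists z, K z /\ U z < Us + n.+1%:R^-1.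
  have n0 : 0 < n.+1%:R^-1 :> R by rewrite invr_gt0 ltr0n.
  by have [_ [z Kz <-] zl] := inf_adherent n0 infU; exists z.
have Kz n : K (z n) by case: (zP n).
have zc : cvg (z @ \oo).
  apply/cauchy_cvgP; apply: cauchy_exP => e e0.
  have e'0 : 0 < (8 / mu)^-1 * e ^+ 2.
    by rewrite mulr_gt0 ?invr_gt0 ?divr_gt0 ?exprn_gt0.
  near \oo => N; exists (z N).
  suff : \forall n \near \oo, ball (z N) e (z n) by [].
  near=> n; rewrite -ball_normE /=; apply: le_lt_trans (mx_norm_le_enorm _) _.
  rewrite -(@ltr_pXn2r _ 2) ?nnegrE ?enorm_ge0 // 1?ltW //.
  have hN : 8 / mu * N.+1%:R^-1 < e ^+ 2.
    rewrite -ltr_pdivlMl ?divr_gt0 //; near: N.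
    exact: (near_infty_natSinv_lt (PosNum e'0)).
  have hn : n.+1%:R^-1 <= N.+1%:R^-1 :> R.
    by rewrite lef_pV2 ?posrE ?ltr0n // ler_nat ltnS; near: n; exact: nbhs_infty_ge.
  have h2 : 0 <= (1 / 2 : R) <= 1 by lra.
  have := midpoint _ _ _ (Kz N) (Kz n) h2.
  have := (zP N).2; have := (zP n).2.
  move: hn hN; set iN := N.+1%:R^-1; set i_n := n.+1%:R^-1; set E := enorm _ ^+ 2.
  move=> hn hN u1 u2 u3.
  have : mu * E <= 8 * iN by lra.
  rewrite -ler_pdivlMl // => /le_lt_trans; apply.
  by rewrite mulrA (mulrC mu^-1).
set xb := lim (z @ \oo).
have zxb : z @ \oo --> xb by exact: zc.
have Kxb : K xb by apply: (closed_cvg K clK _ _ zxb); exact: nearW.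
have Fz : F (z n) @[n --> \oo] --> F xb.
  by apply: continuous_cvg => //; exact: Fcont.
have Uz : U (z n) @[n --> \oo] --> Us.
  have near_U : \forall n \near \oo, Us <= U (z n) <= Us + n.+1%:R^-1.
    by apply: nearW => n; rewrite Ule //=; exact/ltW/(zP n).2.
  apply: (squeeze_cvgr near_U); first exact: cvg_cst.
  by rewrite -[X in _ --> X]addr0; apply: cvgD; [exact: cvg_cst|exact: cvg_harmonic].
have Gz : G (z n) @[n --> \oo] --> Us - F xb.
  have -> : (fun n => G (z n)) = (fun n => U (z n) - F (z n)).
    by apply/funext => n; rewrite /U; ring.
  exact: cvgB.
exists xb, (Us - F xb); split => //.
- move=> x Kx; set A := mu / 2 * _; set B := F x + G x - Us.
  have A0 : 0 <= A by rewrite mulr_ge0 ?dotpp_ge0 // divr_ge0 // ltW.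
  (* [U xb] may exceed [Us], so growth cannot be read off at [xb] itself. Strong convexity between
     [x] and [z n] is passed to the limit and divided by [1 - t]. *)
  have tAB (t : R) : 0 <= t < 1 -> t * A <= B.
    move=> /andP[t0 t1]; have t01 : 0 <= t <= 1 by rewrite t0 ltW.
    have L : (1 - t) * U x + t * U (z n) - mu / 2 * t * (1 - t) * enorm (x - z n) ^+ 2
      @[n --> \oo] --> (1 - t) * U x + t * Us - mu / 2 * t * (1 - t) * enorm (x - xb) ^+ 2.
      have Le : enorm (x - z n) @[n --> \oo] --> enorm (x - xb).
        have L1 : x - z n @[n --> \oo] --> x - xb by apply: cvgB => //; exact: cvg_cst.
        exact: (cvg_comp _ _ L1 (@continuous_enorm R d (x - xb))).
      apply: cvgB; first by apply: cvgD; [exact: cvg_cst|apply: cvgMl_tmp].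
      by apply: cvgMl_tmp; rewrite expr2; under eq_fun do rewrite expr2; exact: cvgM.
    have : Us <= (1 - t) * U x + t * Us - mu / 2 * t * (1 - t) * enorm (x - xb) ^+ 2.
      apply: (cvgr_to_ge L); apply: nearW => n; exact: midpoint.
    rewrite sqr_enorm => i1.
    have t1' : 0 < 1 - t by rewrite subr_gt0.
    rewrite -(ler_pM2l t1') /A /B -[F x + G x]/(U x); lra.
  have Bp : 0 <= B by have := tAB 0 (introT andP (conj (lexx 0) ltr01)); rewrite mul0r.
  rewrite leNgt; apply/negP => BA.
  have Ap : 0 < A by exact: le_lt_trans BA.
  (* If [B < A], a weight halfway between [B / A] and 1 contradicts [tAB]. *)
  have := tAB ((B / A + 1) / 2).
  have BA1 : B / A < 1 by rewrite ltr_pdivrMr // mul1r.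
  have BA0 : 0 <= B / A by rewrite divr_ge0.
  have -> : (B / A + 1) / 2 * A = (B + A) / 2 by field; rewrite gt_eqF.
  have -> : 0 <= (B / A + 1) / 2 < 1 by apply/andP; split; lra.
  by move=> /(_ isT); lra.
- move=> w Kw; have [h1 _ _] := Fg _ Kxb; apply: (first_order_optimality h1) => t /andP[t0 t1].
  have t01 : 0 <= t <= 1 by rewrite ltW.
  rewrite addrC subrK.
  have L : F (z n + t *: (w - z n)) + ((1 - t) * G (z n) + t * G w)
      @[n --> \oo] --> F (xb + t *: (w - xb)) + ((1 - t) * (Us - F xb) + t * G w).
    apply: cvgD; last by apply: cvgD; [apply: cvgMl_tmp|exact: cvg_cst].
    have L1 : z n + t *: (w - z n) @[n --> \oo] --> xb + t *: (w - xb).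
      by apply: cvgD => //; apply: cvgZl_tmp; apply: cvgB => //; exact: cvg_cst.
    exact: (cvg_comp _ _ L1 (Fcont _ (segment_mem cK Kxb Kw t01))).
  apply: (cvgr_to_ge L); apply: nearW => n.
  apply: le_trans (Ule _ (segment_mem cK (Kz n) Kw t01)) _; rewrite lerD2l.
  have E : z n + t *: (w - z n) = (1 - t) *: z n + t *: w.
    by apply/rowP => j; rewrite !mxE; ring.
  by rewrite E cG //; exact: cK.
- move=> a c ac.
  have L : dotp a (z n) + G (z n) - c @[n --> \oo] --> dotp a xb + (Us - F xb) - c.
    apply: cvgB; last exact: cvg_cst.
    apply: cvgD => //; under eq_fun do rewrite dotpC; rewrite dotpC.
    exact: (cvg_comp _ _ zxb (@continuous_dotpl R d a xb)).
  by apply: (cvgr_to_ge L); apply: nearW => n; exact: ac.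
Unshelve. all: by end_near. Qed.

End Convexity.

(** * One agent, one surrogate minimization *)

Section LocalStep.
Variables (R : realType) (d : nat).
Notation V := 'rV[R]_d.
Variables (K : set V) (F G psi : V -> R) (gF gpsi : V -> V)
  (HF Hpsi : V -> 'M[R]_d) (mu mut Dl D : R) (x xh y : V).
Hypotheses (cK : convex_setR K) (cG : convex_fun_on K G)
  (Fg : second_order K F gF HF) (psig : second_order K psi gpsi Hpsi)
  (mu0 : 0 < mu)
  (Fmu : forall z, K z -> forall u, mu * dotp u u <= dotp (u *m HF z) u)
  (mut0 : 0 < mut) (psimut : strongly_convex_fun_on K mut psi)
  (HDl : forall z, K z -> forall u,
    Dl * dotp u u <= dotp (u *m (Hpsi z - HF z)) u)
  (D0 : 0 <= D)
  (HD : forall z, K z -> forall u,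
    `|dotp (u *m (Hpsi z - HF z)) u| <= D * dotp u u)
  (Kx : K x) (Kxh : K xh)
  (xh_opt : forall z, K z ->
    0 <= dotp (gpsi xh + (y - gpsi x)) (z - xh) + G z - G xh).

Lemma surrogate_gap_lipschitz p q : K p -> K q ->
  enorm ((gpsi p - gF p) - (gpsi q - gF q)) <= D * enorm (p - q).
Proof.
move=> Kp Kq; have hg := second_orderB psig Fg.
apply: (gradient_lipschitz D0 cK hg _ Kq Kp) => z Kz u v.
by apply: symmetric_form_bound; [have [] := hg z Kz|exact: HD].
Qed.

(** Three sources add up to the quadratic term: strong convexity of [psi] on the segment gives
    [mut/2 * a * (1 - a)], strong convexity at [xh] with the optimality of [xh] gives [mut/2 * a],
    and the lower Hessian bound for [psi - F] gives [Dl/2 * a^2]. *)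
Lemma local_descent (a : R) : 0 <= a <= 1 ->
  F (x + a *: (xh - x)) + G (x + a *: (xh - x)) <= F x + G x
    + a * dotp (gF x - y) (xh - x)
    - a * ((1 - a / 2) * mut + Dl / 2 * a) * dotp (xh - x) (xh - x).
Proof.
move=> a01; set e := xh - x; set w := x + a *: e.
have Kw : K w by exact: segment_mem.
have E : w = (1 - a) *: x + a *: xh by apply/rowP => j; rewrite !mxE; ring.
have h1 := taylor_lower_bound cK (second_orderB psig Fg) HDl Kx Kw.
have h2 := psimut Kx Kxh a01; rewrite -E in h2; have {}h2 := h2 Kw.
have h3 := cG Kx Kxh a01; rewrite -E in h3; have {}h3 := h3 Kw.
have [p1 _ _] := psig Kxh.
have h4 := strongly_convex_lower_bound cK psimut p1 Kxh Kx.
have h5 := xh_opt Kx.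
move: h1 h2 h4 h5; rewrite (_ : w - x = a *: e); last by rewrite /w addrC addrA addNr add0r.
rewrite enormB -[xh - x]/e -(opprB xh x) -[xh - x]/e sqr_enorm.
rewrite !dotpZr !dotpZl !dotpNr !dotpNl !dotpDl !dotpNl !opprK.
move: a01 => /andP[a0 a1] h1 h2 h4 h5.
have m4 := ler_wpM2l a0 h4; have m5 := mulr_ge0 a0 h5.
lra.
Qed.

(** [B] bounds the mismatch at [xh] between the gradient of [F] and the one in the optimality
    condition. With [q = enorm (z - xh)] the gap is at most [B q - mu/2 q^2], whose maximum over [q]
    is [B^2 / (2 mu)]. *)
Lemma local_gap z : K z ->
  F xh + G xh - (F z + G z) <=
    (D * enorm (xh - x) + enorm (gF x - y)) ^+ 2 / (2 * mu).
Proof.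
move=> Kz; set B := D * _ + _.
have h1 := taylor_lower_bound cK Fg Fmu Kxh Kz.
have h2 := xh_opt Kz.
set e := gpsi xh - gF xh - (gpsi x - gF x).
have he : enorm (e - (gF x - y)) <= B.
  apply: le_trans (ler_enormB _ _) _.
  by rewrite lerD2r surrogate_gap_lipschitz.
have E : dotp (gF xh) (z - xh) - dotp (gpsi xh + (y - gpsi x)) (z - xh) =
    - dotp (e - (gF x - y)) (z - xh).
  by rewrite /e !(dotpDl, dotpNl); ring.
have h3 := dotp_le_enorm (e - (gF x - y)) (z - xh).
have h4 := ler_wpM2r (enorm_ge0 (z - xh)) he.
have h5 : 0 <= (mu * enorm (z - xh) - B) ^+ 2 by exact: sqr_ge0.
rewrite ler_pdivlMr ?mulr_gt0 //.
move: h1; rewrite -sqr_enorm; move: h3 h4 h5 E h2.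
set q := enorm (z - xh); set l1 := dotp (gF xh) _; set l2 := dotp (_ + _) _.
set l3 := dotp _ (z - xh) => h3 h4 h5 E h2 h1.
have h6 : F xh + G xh - (F z + G z) <= B * q - mu / 2 * q ^+ 2 by lra.
have := ler_wpM2r (ltW (mulr_gt0 (ltr0n _ 2) mu0)) h6.
lra.
Qed.

(** Optimality of [xh] tested at [xb] and of [xb] tested at [xh] are added, so that all values of
    [G] cancel; strong monotonicity of [gpsi] bounds what remains. The surrogate gap is compared
    between [xb] and [x], hence [enorm (x - xb)] on the right. *)
Lemma local_distance xb Gb : K xb ->
  (forall z, K z -> 0 <= dotp (gF xb) (z - xb) + G z - Gb) ->
  (forall a c, (forall z, K z -> 0 <= dotp a z + G z - c) ->
      0 <= dotp a xb + Gb - c) ->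
  mut * enorm (xh - xb) <= D * enorm (x - xb) + enorm (gF x - y).
Proof.
move=> Kxb xb_opt xb_lim.
set a := gpsi xh + (y - gpsi x).
have h1 : 0 <= dotp a (xb - xh) + Gb - G xh.
  have : 0 <= dotp a xb + Gb - (G xh + dotp a xh).
    by apply: xb_lim => z Kz; have := xh_opt Kz; rewrite dotpBr; lra.
  by rewrite dotpBr; lra.
have h2 := xb_opt _ Kxh.
have [p1 _ _] := psig Kxh; have [p2 _ _] := psig Kxb.
have h3 := strongly_convex_monotone cK psimut p2 p1 Kxb Kxh.
set e := gpsi xb - gF xb - (gpsi x - gF x).
have E : - dotp (e - (gF x - y)) (xh - xb) = dotp a (xb - xh) +
    dotp (gF xb) (xh - xb) + dotp (gpsi xh - gpsi xb) (xh - xb).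
  by rewrite /e /a -(opprB xh xb) dotpNr !(dotpDl, dotpNl); ring.
have he : enorm (e - (gF x - y)) <= D * enorm (x - xb) + enorm (gF x - y).
  apply: le_trans (ler_enormB _ _) _; rewrite lerD2r [enorm (x - xb)]enormB.
  exact: surrogate_gap_lipschitz.
have h4 : mut * enorm (xh - xb) ^+ 2 <=
    (D * enorm (x - xb) + enorm (gF x - y)) * enorm (xh - xb).
  have := dotp_le_enorm (- (e - (gF x - y))) (xh - xb).
  have := ler_wpM2r (enorm_ge0 (xh - xb)) he.
  rewrite enormN dotpNl sqr_enorm; lra.
have [/eqP w0|w0] := boolP (enorm (xh - xb) == 0).
  by rewrite w0 mulr0 addr_ge0 ?mulr_ge0 ?enorm_ge0.
have wp : 0 < enorm (xh - xb) by rewrite lt_def w0 enorm_ge0.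
by rewrite -(ler_pM2r wp) -mulrA -expr2.
Qed.

End LocalStep.

(* The weights [2 D^2] and [s mu] of the two bounds are those for which the
   terms in [e^2] cancel. *)
Lemma step_contraction (R : realType) (alpha s D mu a ap e r : R) :
  0 <= alpha -> 0 < s -> 0 < mu ->
  ap <= a + alpha * (r * e) - alpha * s * e ^+ 2 ->
  ap <= (1 - alpha) * a + alpha * ((D * e + r) ^+ 2 / (2 * mu)) ->
  ap <= (1 - alpha * (s * mu / (2 * D ^+ 2 + s * mu))) * a
    + alpha * ((D ^+ 2 / s + s) / (2 * D ^+ 2 + s * mu)) * r ^+ 2.
Proof.
move=> al0 s0 mu0 h1 h2; set N := 2 * D ^+ 2 + s * mu.
have N0 : 0 < N by rewrite ltr_wpDl ?mulr_gt0 // mulr_ge0 ?sqr_ge0.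
have q1 : r * e <= s / 2 * e ^+ 2 + r ^+ 2 / (2 * s).
  rewrite -(ler_pM2l s0).
  have -> : s * (s / 2 * e ^+ 2 + r ^+ 2 / (2 * s)) = (s ^+ 2 * e ^+ 2 + r ^+ 2) / 2.
    by field; rewrite gt_eqF.
  have := sqr_ge0 (s * e - r); lra.
have q2 : (D * e + r) ^+ 2 / (2 * mu) <= (D ^+ 2 * e ^+ 2 + r ^+ 2) / mu.
  rewrite ler_pdivrMr ?mulr_gt0 // mulrA [_ * 2]mulrC mulrA divfK ?gt_eqF //.
  have := sqr_ge0 (D * e - r); lra.
have j1 : ap <= a - alpha * (s / 2) * e ^+ 2 + alpha * (r ^+ 2 / (2 * s)).
  have := ler_wpM2l al0 q1; lra.
have j2 : ap <= (1 - alpha) * a + alpha * ((D ^+ 2 * e ^+ 2 + r ^+ 2) / mu).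
  have := ler_wpM2l al0 q2; lra.
rewrite -(ler_pM2l N0).
have -> : N * ((1 - alpha * (s * mu / N)) * a + alpha * ((D ^+ 2 / s + s) / N) * r ^+ 2)
    = 2 * D ^+ 2 * (a - alpha * (s / 2) * e ^+ 2 + alpha * (r ^+ 2 / (2 * s)))
    + s * mu * ((1 - alpha) * a + alpha * ((D ^+ 2 * e ^+ 2 + r ^+ 2) / mu)).
  have N0' : 2 * D ^+ 2 + s * mu != 0 by rewrite gt_eqF.
  by rewrite /N; field; rewrite !gt_eqF.
rewrite /N mulrDl lerD //.
  by rewrite ler_wpM2l // mulr_ge0 ?sqr_ge0.
by rewrite ler_wpM2l // ltW ?mulr_gt0.
Qed.

(** * Largest eigenvalue and Rayleigh quotient of a symmetric matrix *)

Section Spectral.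
Variables (R : realType) (n : nat).
Notation V := 'rV[R]_n.

(* A maximizer [v] of the Rayleigh quotient is an eigenvector, since the
   nonnegative form [l |w|^2 - w S w^T] vanishes at [v]. *)
Lemma quadratic_form_le_eigenvalue (S : 'M[R]_n) (c : R) :
  (forall u v, dotp (u *m S) v = dotp (v *m S) u) ->
  (forall a, eigenvalue S a -> a <= c) ->
  forall u, dotp (u *m S) u <= c * dotp u u.
Proof.
move=> sS Sc u; have [->|u0] := eqVneq u 0.
  by rewrite mul0mx !dot0p mulr0.
pose A := [set w : V | enorm w = 1].
have unit w : w != 0 -> A ((enorm w)^-1 *: w).
  move=> w0; rewrite /A /= enormZ ger0_norm ?invr_ge0 ?enorm_ge0 //.
  by rewrite mulVf // enorm_eq0.
have cA : compact A.
  apply: bounded_closed_compact.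
    exists 1; split => // M M1 w /= w1.
    by apply: le_trans (mx_norm_le_enorm _) _; rewrite w1 ltW.
  have -> : A = @enorm R n @^-1` [set 1] by [].
  by apply: (closed_comp _ (@closed_eq R 1)) => w _; exact: continuous_enorm.
have cf : continuous (fun w : V => dotp (w *m S) w).
  have -> : (fun w : V => dotp (w *m S) w) =
      (fun w => \sum_k \sum_j (w 0 j * S j k * w 0 k)).
    apply/funext => w; rewrite dotpE; apply: eq_bigr => k _.
    by rewrite mxE mulr_suml.
  apply: (@continuous_big _ _ _ _ _ _ V) => [|k _]; first exact: add_continuous.
  apply: (@continuous_big _ _ _ _ _ _ V) => [|j _ x]; first exact: add_continuous.
  have hj := @coord_continuous R 1 n 0 j x.
  have hk := @coord_continuous R 1 n 0 k x.
  apply: (@cvgM R _ (nbhs x) _ (fun w : V => w 0 j * S j k) (fun w : V => w 0 k)) => //.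
  apply: (@cvgM R _ (nbhs x) _ (fun w : V => w 0 j) (fun=> S j k)) => //.
  exact: cvg_cst.
have A0 : A !=set0 by exists ((enorm u)^-1 *: u); exact: unit.
have [v] := EVT_max_rV A0 cA (continuous_subspaceT cf).
rewrite inE => Av vmax.
set l := dotp (v *m S) v in vmax.
have lw w : dotp (w *m S) w <= l * dotp w w.
  have [->|w0] := eqVneq w 0; first by rewrite mul0mx !dot0p mulr0.
  have wp : 0 < enorm w by rewrite lt_def enorm_eq0 w0 enorm_ge0.
  have := vmax _ (mem_set (unit _ w0)).
  rewrite -scalemxAl dotpZl dotpZr mulrA -expr2 exprVn.
  by rewrite mulrC ler_pdivrMr ?exprn_gt0 // sqr_enorm.
have vv : dotp v v = 1 by rewrite -sqr_enorm Av expr1n.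
have vS : v *m S = l *: v.
  apply/eqP; rewrite eq_sym -subr_eq0; set w := l *: v - v *m S.
  rewrite -dotpp_eq0; set p := dotp w w.
  set q := l * dotp w w - dotp (w *m S) w.
  have q0 : 0 <= q by rewrite subr_ge0 lw.
  have p0 : 0 <= p by exact: dotpp_ge0.
  (* The summand 1 covers [q = 0]. As [t * q < 2 * p] when [p > 0], the nonnegative form would be
     negative at [v - t *: w]. *)
  set t := p / (q + 1).
  have qp : 0 < q + 1 by rewrite ltr_wpDl.
  have tE : t * (q + 1) = p by rewrite /t divfK ?gt_eqF.
  have := lw (v - t *: w).
  rewrite mulmxBl !(dotpBl, dotpBr) -!scalemxAl !(dotpZl, dotpZr) (sS w v) (dotpC w v).
  have pE : p = l * dotp v w - dotp (v *m S) w by rewrite /p {1}/w dotpBl dotpZl.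
  rewrite vv -/l => i1.
  have i2 : 0 <= - 2 * t * p + t ^+ 2 * q by rewrite pE /q; lra.
  rewrite eq_le p0 andbT leNgt; apply/negP => pp.
  have t0 : 0 < t by rewrite divr_gt0.
  have : 0 <= t * (- 2 * p + t * q) by lra.
  by rewrite pmulr_rge0 //; lra.
apply: le_trans (lw u) _; apply: ler_wpM2r; first exact: dotpp_ge0.
apply: Sc; apply/eigenvalueP; exists v => //.
by rewrite -dotpp_eq0 vv oner_eq0.
Qed.

End Spectral.

(** * Eigenvalues of a tensor product with the identity *)

Section TensorIdentity.
Variables (R : realType) (m d : nat).

(** An eigenvector is nonzero, so the hypothesis on [rho] already forces [d] to be positive. *)
Lemma eigenvalue_tens1_ord (S : 'M[R]_m) (a : R) :
  eigenvalue (S *t (1%:M : 'M[R]_d)) a -> (0 < d)%N.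
Proof.
case/eigenvalueP => w _ w0; case: (posnP d) => // d0.
case/eqP: w0; apply/rowP => k; case: (mxtens_indexP k) => i j.
by exfalso; have := ltn_ord j; rewrite [X in (_ < X)%N]d0 ltn0.
Qed.

(** A slice of an eigenvector through a nonzero entry is an eigenvector of [S]; conversely one
    tensors with a basis vector. *)
Lemma eigenvalue_tens1 (S : 'M[R]_m) (a : R) : (0 < d)%N ->
  eigenvalue (S *t (1%:M : 'M[R]_d)) a = eigenvalue S a.
Proof.
move=> d0; apply/eigenvalueP/eigenvalueP => [[w wS w0]|[v vS v0]].
  have [k wk] : exists k, w 0 k != 0.
    apply/existsP; apply: contraNT w0; rewrite negb_exists => /forallP w0.
    by apply/eqP/rowP => k; rewrite mxE; apply/eqP; rewrite -[_ == _]negbK.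
  case: (mxtens_indexP k) wk => i j wk.
  exists (\row_i w 0 (mxtens_index (i, j))); last first.
    by apply: contraNneq wk => /rowP /(_ i); rewrite !mxE => ->.
  apply/rowP => l; have /rowP /(_ (mxtens_index (l, j))) := wS.
  rewrite !mxE => <-; rewrite (reindex (@mxtens_index m d)) /=; last first.
    by exists (@mxtens_unindex m d) => k' _; rewrite (mxtens_indexK, mxtens_unindexK).
  transitivity (\sum_i' \sum_j' w 0 (mxtens_index (i', j')) *
      (S *t 1%:M) (mxtens_index (i', j')) (mxtens_index (l, j))).
    apply: eq_bigr => i' _; rewrite (bigD1 j) //= big1 ?addr0.
      by rewrite tensmxE !mxE eqxx mulr1.
    by move=> j' jj; rewrite tensmxE !mxE (negPf jj) !mulr0.
  by rewrite pair_big; apply: eq_bigr => -[i' j'].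
pose e : 'rV[R]_d := delta_mx 0 (Ordinal d0).
have vE (w : 'rV[R]_m) k j : (w *t e : 'rV_(m * d)) 0 (mxtens_index (k, j)) = w 0 k * e 0 j.
  rewrite -(tensmxE w e 0 0 k j); congr ((_ *t _) _ _); exact: val_inj.
exists (v *t e : 'rV_(m * d)).
  rewrite (tensmx_mul v e S) vS mulmx1.
  by apply/rowP => k; case: (mxtens_indexP k) => i j; rewrite [RHS]mxE !vE mxE mulrA.
have [k vk] : exists k, v 0 k != 0.
  apply/existsP; apply: contraNT v0; rewrite negb_exists => /forallP v0.
  by apply/eqP/rowP => k; rewrite mxE; apply/eqP; rewrite -[_ == _]negbK.
apply: contraNneq vk => /rowP /(_ (mxtens_index (k, Ordinal d0))).
by rewrite vE !mxE !eqxx mulr1 => ->.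
Qed.

End TensorIdentity.

(** * Families indexed by the agents: mixing, mean and consensus error *)

Section Families.
Variables (R : realType) (m d : nat).
Notation V := 'rV[R]_d.
Implicit Types (u v : 'I_m -> V) (A W : 'M[R]_m).

(** Norm of the stacked vector, written as a norm of norms so that the triangle inequality reduces
    to the one for row vectors. *)
Definition fnorm u := enorm (\row_i enorm (u i)).
Definition mix A u (i : 'I_m) : V := \sum_j A i j *: u j.
Definition mean u : V := m%:R^-1 *: \sum_j u j.
Definition perp u (i : 'I_m) : V := u i - mean u.

Lemma fnorm_ge0 u : 0 <= fnorm u.
Proof. exact: enorm_ge0. Qed.

Lemma sqr_fnorm u : fnorm u ^+ 2 = \sum_i dotp (u i) (u i).
Proof.
by rewrite sqr_enorm dotpE; apply: eq_bigr => i _; rewrite mxE -expr2 sqr_enorm.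
Qed.

Lemma le_fnorm (c : R) u v : 0 <= c -> (forall i, enorm (u i) <= c * enorm (v i)) ->
  fnorm u <= c * fnorm v.
Proof.
move=> c0 uv; rewrite -(@ler_pXn2r _ 2) ?nnegrE ?mulr_ge0 ?fnorm_ge0 //.
rewrite exprMn !sqr_fnorm mulr_sumr; apply: ler_sum => i _.
by rewrite -!sqr_enorm -exprMn ler_pXn2r ?nnegrE ?mulr_ge0 ?enorm_ge0.
Qed.

Lemma fnormZ (c : R) u : 0 <= c -> fnorm (fun i => c *: u i) <= c * fnorm u.
Proof. by move=> c0; apply: le_fnorm => // i; rewrite enormZ ger0_norm. Qed.

Lemma ler_fnormD u v : fnorm (fun i => u i + v i) <= fnorm u + fnorm v.
Proof.
apply: le_trans (ler_enormD _ _).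
rewrite -(@ler_pXn2r _ 2) ?nnegrE ?enorm_ge0 // !sqr_enorm !dotpE.
apply: ler_sum => i _; rewrite !mxE -!expr2.
by rewrite ler_pXn2r ?nnegrE ?addr_ge0 ?enorm_ge0 // ler_enormD.
Qed.

Lemma ler_fnormB u v : fnorm (fun i => u i - v i) <= fnorm u + fnorm v.
Proof.
apply: le_trans (ler_fnormD u (fun i => - v i)) _; rewrite lerD2l.
by rewrite -[leRHS]mul1r; apply: le_fnorm => // i; rewrite enormN mul1r.
Qed.

Lemma sum_dotp_coord u :
  \sum_i dotp (u i) (u i) = \sum_k dotp (\row_i u i 0 k) (\row_i u i 0 k).
Proof.
transitivity (\sum_i \sum_k u i 0 k * u i 0 k).
  by apply: eq_bigr => i _; rewrite dotpE.
rewrite exchange_big /=; apply: eq_bigr => k _.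
by rewrite dotpE; apply: eq_bigr => i _; rewrite !mxE.
Qed.

(** Mixing acts on each of the [d] coordinates separately, so a bound on vectors indexed by the
    agents carries over with the same constant. *)
Lemma fnorm_mix A (c : R) u : 0 <= c ->
  (forall w : 'rV[R]_m, dotp (w *m A^T) (w *m A^T) <= c ^+ 2 * dotp w w) ->
  fnorm (mix A u) <= c * fnorm u.
Proof.
move=> c0 Ac; rewrite -(@ler_pXn2r _ 2) ?nnegrE ?mulr_ge0 ?fnorm_ge0 //.
rewrite exprMn !sqr_fnorm.
rewrite !sum_dotp_coord mulr_sumr; apply: ler_sum => k _.
have -> : \row_i mix A u i 0 k = (\row_i u i 0 k) *m A^T.
  by apply/rowP => i; rewrite !mxE summxE; apply: eq_bigr => j _; rewrite !mxE mulrC.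
exact: Ac.
Qed.

(** The difference of the two sides is the weighted variance of [a]. *)
Lemma jensen_sqr (w a : 'I_m -> R) : (forall j, 0 <= w j) -> \sum_j w j = 1 ->
  (\sum_j w j * a j) ^+ 2 <= \sum_j w j * a j ^+ 2.
Proof.
move=> w0 w1; have [s sE] : exists s, s = \sum_j w j * a j by eexists.
rewrite -sE; have : 0 <= \sum_j w j * (a j - s) ^+ 2.
  by apply: sumr_ge0 => j _; rewrite mulr_ge0 ?sqr_ge0.
have -> : \sum_j w j * (a j - s) ^+ 2 =
    \sum_j w j * a j ^+ 2 - 2 * s * s + s ^+ 2 * \sum_j w j.
  have -> : 2 * s * s = \sum_j 2 * s * (w j * a j) by rewrite -mulr_sumr sE.
  rewrite mulr_sumr -sumrB -big_split /=; apply: eq_bigr => j _.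
  ring.
by rewrite w1; lra.
Qed.

(** The convexity predicates are binary; the induction merges one point at a time into an
    accumulated point [p] of weight [c], starting from weight 0. *)
Lemma convex_comb_mem (K : set V) (U : V -> R) (w : 'I_m -> R) (z : 'I_m -> V) :
  convex_setR K -> convex_fun_on K U -> (forall j, 0 <= w j) ->
  \sum_j w j = 1 -> (forall j, K (z j)) ->
  K (\sum_j w j *: z j) /\ U (\sum_j w j *: z j) <= \sum_j w j * U (z j).
Proof.
move=> cK cU w0 w1 Kz.
have gen (r : seq 'I_m) : forall (c : R) p, 0 <= c -> K p ->
    c + \sum_(j <- r) w j = 1 ->
    K (c *: p + \sum_(j <- r) w j *: z j) /\
    U (c *: p + \sum_(j <- r) w j *: z j) <= c * U p + \sum_(j <- r) w j * U (z j).
  elim: r => [|i r IH] c p c0 Kp.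
    by rewrite !big_nil !addr0 => ->; rewrite scale1r mul1r.
  rewrite !big_cons => cw.
  have [s0|s0] := eqVneq (c + w i) 0.
    have ci0 : c = 0 by have := w0 i; lra.
    have wi0 : w i = 0 by lra.
    have := IH 0 p (lexx 0) Kp; rewrite ci0 wi0 !scale0r !mul0r !add0r => IHr.
    by apply: IHr; lra.
  have sp : 0 < c + w i by rewrite lt_def s0 addr_ge0.
  set t := w i / (c + w i).
  have t01 : 0 <= t <= 1.
    by rewrite divr_ge0 ?(ltW sp) //= ler_pdivrMr // mul1r lerDr.
  have ts : (c + w i) * t = w i by rewrite mulrC divfK.
  have Kq := cK _ _ _ Kp (Kz i) t01.
  have Uq := cU _ _ _ Kp (Kz i) t01 Kq.
  have E : (c + w i) *: ((1 - t) *: p + t *: z i) = c *: p + w i *: z i.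
    rewrite scalerDr !scalerA mulrBr mulr1 ts addrK //.
  have := IH (c + w i) _ (ltW sp) Kq; rewrite E -!addrA => /(_ cw)[Kr Ur]; split=> //.
  apply: le_trans Ur _; rewrite !addrA lerD2r.
  apply: le_trans (ler_wpM2l (ltW sp) Uq) _.
  rewrite (_ : _ * (_ + _) = (c + w i) * U p + (c + w i) * t * (U (z i) - U p)); last by ring.
  by rewrite ts; lra.
have [p Kp] : exists p, K p.
  have [i] : exists i : 'I_m, true.
    apply/existsP/contraT; rewrite negb_exists => /forallP H.
    by move: w1; rewrite big1 => [/eqP|j _]; [rewrite eq_sym oner_eq0|have := H j].
  by exists (z i).
have := gen (index_enum 'I_m) 0 p (lexx 0) Kp.
by rewrite scale0r mul0r !add0r; exact.
Qed.

Hypothesis m0 : (0 < m)%N.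

Let mR : m%:R != 0 :> R. Proof. by rewrite pnatr_eq0 -lt0n. Qed.

Lemma sum_perp u : \sum_i perp u i = 0.
Proof.
rewrite sumrB sumr_const card_ord -scaler_nat scalerA divff // scale1r.
exact: subrr.
Qed.

(** Parallel-axis identity: the cross terms vanish because the deviations sum to 0. *)
Lemma sum_sqr_perp u (c : V) :
  \sum_i dotp (u i - c) (u i - c) = fnorm (perp u) ^+ 2 + m%:R * dotp (mean u - c) (mean u - c).
Proof.
rewrite sqr_fnorm.
have E i : dotp (u i - c) (u i - c) = dotp (perp u i) (perp u i) +
    2 * dotp (perp u i) (mean u - c) + dotp (mean u - c) (mean u - c).
  have -> : u i - c = perp u i + (mean u - c) by rewrite /perp addrA subrK.
  move: (perp u i) (mean u - c) => p q.
  by rewrite dotpDl !dotpDr (dotpC q p); ring.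
rewrite (eq_bigr _ (fun i _ => E i)) !big_split /= -mulr_sumr -dotp_suml.
by rewrite sum_perp dot0p mulr0 addr0 sumr_const card_ord mulr_natl.
Qed.

Lemma fnorm_perp_le u (c : V) : fnorm (perp u) ^+ 2 <= \sum_i dotp (u i - c) (u i - c).
Proof. by rewrite (sum_sqr_perp u c) lerDl mulr_ge0 ?dotpp_ge0. Qed.

Lemma sum_sqr_pairs u :
  m%:R^-1 * \sum_i \sum_j dotp (u i - u j) (u i - u j) = 2 * fnorm (perp u) ^+ 2.
Proof.
rewrite exchange_big /= (eq_bigr _ (fun j _ => sum_sqr_perp u (u j))) big_split /=.
rewrite sumr_const card_ord -mulr_sumr -[fnorm _ ^+ 2 *+ _]mulr_natl.
rewrite -mulrDr mulrA mulVf // mul1r.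
rewrite mulr_natl mulr2n sqr_fnorm; congr (_ + _); apply: eq_bigr => i _.
by rewrite -(opprB (u i)) dotpNl dotpNr opprK.
Qed.

Section DoublyStochastic.
Variable W : 'M[R]_m.
Hypotheses (W0 : forall i j, 0 <= W i j) (Wr : forall i, \sum_j W i j = 1)
  (Wc : forall j, \sum_i W i j = 1).

Definition deviation : 'M[R]_m := W - m%:R^-1 *: const_mx 1.

Lemma sum_mix u : \sum_i mix W u i = \sum_i u i.
Proof.
rewrite exchange_big /=; apply: eq_bigr => j _.
by rewrite -scaler_suml Wc scale1r.
Qed.

Lemma mean_mix u : mean (mix W u) = mean u.
Proof. by rewrite /mean sum_mix. Qed.

Lemma mix_cst (c : V) i : mix W (fun=> c) i = c.
Proof. by rewrite /mix -scaler_suml Wr scale1r. Qed.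

Lemma mixB A u v i : mix A (fun j => u j - v j) i = mix A u i - mix A v i.
Proof. by rewrite /mix -sumrB; apply: eq_bigr => j _; rewrite scalerBr. Qed.

Lemma mixD A u v i : mix A (fun j => u j + v j) i = mix A u i + mix A v i.
Proof. by rewrite /mix -big_split; apply: eq_bigr => j _; rewrite scalerDr. Qed.

Lemma perp_mix u : perp (mix W u) = mix deviation u.
Proof.
apply/funext => i; rewrite /perp mean_mix /mix /mean scaler_sumr -sumrB.
by apply: eq_bigr => j _; rewrite !mxE mulr1 scalerBl.
Qed.

Lemma mix_deviation_perp u : mix deviation (perp u) = mix deviation u.
Proof.
apply/funext => i; rewrite mixB; suff -> : mix deviation (fun=> mean u) i = 0.
  by rewrite subr0.
rewrite /mix -scaler_suml (eq_bigr (fun j => W i j - m%:R^-1)); last first.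
  by move=> j _; rewrite !mxE mulr1.
by rewrite sumrB Wr sumr_const card_ord -[_^-1 *+ _]mulr_natl divff // subrr scale0r.
Qed.

(** Jensen in each row, then the column sums. *)
Lemma stochastic_nonexpansive (w : 'rV[R]_m) :
  dotp (w *m W^T) (w *m W^T) <= dotp w w.
Proof.
rewrite !dotpE; apply: (@le_trans _ _ (\sum_i \sum_j W i j * w 0 j ^+ 2)).
  apply: ler_sum => i _; rewrite -expr2 mxE.
  apply: le_trans (jensen_sqr (w 0) (W0 i) (Wr i)); rewrite le_eqVlt; apply/orP; left.
  by apply/eqP; congr (_ ^+ 2); apply: eq_bigr => j _; rewrite mxE mulrC.
rewrite exchange_big /=; apply: ler_sum => j _.
by rewrite -mulr_suml Wc mul1r expr2.
Qed.

(** Subtracting the mean of the mixed vector only shortens it. This is the source of [rho <= 1]. *)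
Lemma deviation_nonexpansive (w : 'rV[R]_m) :
  dotp (w *m deviation^T) (w *m deviation^T) <= dotp w w.
Proof.
apply: le_trans (stochastic_nonexpansive w).
set s := m%:R^-1 * \sum_j w 0 j.
have E i : (w *m deviation^T) 0 i = (w *m W^T) 0 i - s.
  rewrite !mxE /s mulr_sumr -sumrB; apply: eq_bigr => j _; rewrite !mxE; ring.
have S : \sum_i (w *m W^T) 0 i = m%:R * s.
  rewrite /s mulrA divff // mul1r; under eq_bigr do rewrite mxE.
  rewrite exchange_big /=; apply: eq_bigr => j _.
  by under eq_bigr do rewrite mxE; rewrite -mulr_sumr Wc mulr1.
rewrite !dotpE.
have -> : \sum_k (w *m deviation^T) 0 k * (w *m deviation^T) 0 k =
    \sum_k ((w *m W^T) 0 k * (w *m W^T) 0 k - 2 * s * (w *m W^T) 0 k + s ^+ 2).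
  by apply: eq_bigr => k _; rewrite !E; ring.
rewrite big_split /= sumrB -mulr_sumr S sumr_const card_ord -[s ^+ 2 *+ _]mulr_natl.
have : 0 <= m%:R * s ^+ 2 by rewrite mulr_ge0 ?sqr_ge0.
lra.
Qed.

Lemma consensus_matrix_deviation :
  consensus_matrix m d W = deviation *t (1%:M : 'M[R]_d).
Proof.
apply/matrixP => p q; case: (mxtens_indexP p) => i k; case: (mxtens_indexP q) => j l.
by rewrite tensmxE !mxE !mxtens_indexK /=; ring.
Qed.

(** The Gram matrix of the consensus matrix is [B^T *m B] tensored with the identity, so [rho ^+ 2]
    bounds the eigenvalues of the symmetric [B^T *m B] even if [W] is not symmetric; the Rayleigh
    bound does the rest. *)
Lemma consensus_contraction rho :
  largest_singular_value (consensus_matrix m d W) rho ->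
  [/\ (0 < d)%N, 0 <= rho <= 1 & forall w : 'rV[R]_m,
     dotp (w *m deviation^T) (w *m deviation^T) <= rho ^+ 2 * dotp w w].
Proof.
set B := deviation; case=> rho0; rewrite consensus_matrix_deviation.
have -> : (B *t (1%:M : 'M[R]_d))^T *m (B *t (1%:M : 'M[R]_d)) =
    (B^T *m B) *t (1%:M : 'M[R]_d).
  by rewrite trmx_tens tensmx_mul trmx1 mulmx1.
move=> [rhoE rhomax]; have d0 := eigenvalue_tens1_ord rhoE; split => //.
  rewrite rho0 -(@ler_pXn2r _ 2) ?nnegrE // expr1n.
  move: rhoE; rewrite eigenvalue_tens1 // => /eigenvalueP[v vS v0].
  have vp : 0 < dotp v v by rewrite lt_def dotpp_eq0 v0 dotpp_ge0.
  rewrite -(ler_pM2r vp) mul1r; apply: le_trans (deviation_nonexpansive v).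
  by rewrite -dotpZl -vS /dotp trmx_mul trmxK !mulmxA.
have E (u v : 'rV[R]_m) : dotp (u *m (B^T *m B)) v = dotp (u *m B^T) (v *m B^T).
  by rewrite /dotp trmx_mul trmxK !mulmxA.
move=> w; rewrite -E; apply: quadratic_form_le_eigenvalue => [u v|a].
  by rewrite !E dotpC.
by rewrite -(eigenvalue_tens1 _ _ d0); exact: rhomax.
Qed.

End DoublyStochastic.

End Families.

Lemma weights_ok_ge0 (R : realType) (m : nat) (E : rel 'I_m) (W : 'M[R]_m) :
  weights_ok E W -> forall i j, 0 <= W i j.
Proof.
move=> [Wd [WE [Wn _]]] i j; have [->|ij] := eqVneq i j; first exact: ltW.
have [Eij|nE] := boolP (E i j); first by apply/ltW/(WE i j ij).
by rewrite Wn.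
Qed.

(** * Coupled recursions and the loop inequality *)

Section SmallGain.
Variable R : realType.
Implicit Types (u v : nat -> R).

(** The constant [c = b * V / (r - q)] solves [q * c + b * V = r * c], the recursion along [r ^+ n];
    the initial value only has to be dominated by [a]. *)
Lemma geometric_recursion (r q b a V : R) u v n :
  0 <= q < r -> 0 <= b -> 0 <= a -> 0 <= V -> u 0%N <= a ->
  (forall k, (k < n)%N -> u k.+1 <= q * u k + b * v k) ->
  (forall k, (k < n)%N -> v k <= V * r ^+ k) ->
  u n <= (a + b * V / (r - q)) * r ^+ n.
Proof.
move=> /andP[q0 qr] b0 a0 V0 u0.
have rq : 0 < r - q by rewrite subr_gt0.
have r0 : 0 < r by exact: le_lt_trans qr.
elim: n => [_ _|n IH Hu Hv].
  by rewrite mulr1; apply: le_trans u0 _; rewrite lerDl divr_ge0 ?mulr_ge0 // ltW.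
have := IH (fun k kn => Hu k (ltnW kn)) (fun k kn => Hv k (ltnW kn)).
set c := b * V / (r - q); have cE : c * (r - q) = b * V by rewrite divfK ?gt_eqF.
move=> un; apply: le_trans (Hu n (ltnSn n)) _.
have rn : 0 <= r ^+ n by rewrite exprn_ge0 // ltW.
have h1 := ler_wpM2l q0 un; have h2 := ler_wpM2l b0 (Hv n (ltnSn n)).
have h3 : 0 <= (r - q) * a * r ^+ n by rewrite !mulr_ge0 // ltW.
have h4 : c * (r - q) * r ^+ n = b * V * r ^+ n by rewrite cE.
rewrite exprS; lra.
Qed.

(** [k1] and [k2] are the gains from [e] to [xi] and [zeta], and [2 * gp] the gain from the squared
    errors to [p]. Strong induction on [e] is possible because the bounds on [zeta n] and [p n]
    involve [e] only at earlier times. *)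
Lemma small_gain (r rho alpha L sigma eta c1 c2 gp : R) (xi zeta p e : nat -> R) :
  0 <= rho < r -> 0 <= sigma < r ^+ 2 -> 0 <= alpha -> 0 <= L -> 0 <= eta ->
  0 <= c1 -> 0 <= c2 -> 0 <= gp -> eta / (r ^+ 2 - sigma) <= 2 * gp ->
  let k1 := rho * alpha / (r - rho) in
  let k2 := rho * L * (2 * k1 + alpha) / (r - rho) in
  8 * gp * c1 * L ^+ 2 * k1 ^+ 2 + (4 * gp * c1 + c2) * k2 ^+ 2 <= 1 ->
  (forall n, 0 <= xi n) -> (forall n, 0 <= zeta n) -> (forall n, 0 <= p n) ->
  (forall n, 0 <= e n) ->
  (forall n, xi n.+1 <= rho * xi n + rho * alpha * e n) ->
  (forall n, zeta n.+1 <= rho * zeta n + rho * L * (2 * xi n + alpha * e n)) ->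
  (forall n, p n.+1 <= sigma * p n + eta * (4 * L ^+ 2 * xi n ^+ 2 + 2 * zeta n ^+ 2)) ->
  (forall n, e n ^+ 2 <= 3 / 4 * (c1 * p n + c2 * zeta n ^+ 2)) ->
  exists C : R, forall n, p n <= C * (r ^+ 2) ^+ n.
Proof.
move=> /andP[rho0 rhor] /andP[sg0 sgr] al0 L0 eta0 c10 c20 gp0 etagp k1 k2 lead.
move=> xi0 zeta0 p0 e0 Hxi Hzeta Hp He.
have t0 : 0 < r - rho by rewrite subr_gt0.
have r0 : 0 < r by exact: le_lt_trans rhor.
have k10 : 0 <= k1 by rewrite divr_ge0 ?mulr_ge0 // ltW.
have k20 : 0 <= k2.
  by apply: divr_ge0; [rewrite !mulr_ge0 // addr_ge0 // mulr_ge0|exact: ltW].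
set a1 := xi 0%N.
set a2 := zeta 0%N + rho * L * (2 * a1) / (r - rho).
have a10 : 0 <= a1 by exact: xi0.
have a20 : 0 <= a2.
  rewrite addr_ge0 //; apply: divr_ge0; last exact: ltW.
  by rewrite !mulr_ge0.
have sqr_le (w c : R) k : 0 <= w -> w <= c * r ^+ k ->
    w ^+ 2 <= c ^+ 2 * (r ^+ 2) ^+ k.
  by move=> w0 wc; rewrite exprAC -exprMn ler_pXn2r ?nnegrE // (le_trans w0).
pose B V := 4 * L ^+ 2 * (a1 + k1 * V) ^+ 2 + 2 * (a2 + k2 * V) ^+ 2.
have B0 V : 0 <= B V.
  by apply: addr_ge0; apply: mulr_ge0; rewrite ?sqr_ge0 // mulr_ge0 ?sqr_ge0.
have bounds V n : 0 <= V -> (forall k, (k < n)%N -> e k <= V * r ^+ k) ->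
    zeta n <= (a2 + k2 * V) * r ^+ n /\
    p n <= (p 0%N + 2 * gp * B V) * (r ^+ 2) ^+ n.
  move=> V0 eV.
  have X k : (k <= n)%N -> xi k <= (a1 + k1 * V) * r ^+ k.
    move=> kn; have -> : k1 * V = rho * alpha * V / (r - rho).
      by rewrite /k1; ring.
    apply: (@geometric_recursion r rho _ a1 V xi e) => //; first by rewrite rho0.
    - by rewrite mulr_ge0.
    - by move=> j jk; apply: eV; exact: leq_trans kn.
  have Y k : (k <= n)%N -> zeta k <= (a2 + k2 * V) * r ^+ k.
    move=> kn.
    have -> : a2 + k2 * V = zeta 0%N + rho * L * (2 * (a1 + k1 * V) + alpha * V) / (r - rho).
      by rewrite /a2 /k2; ring.
    apply: (@geometric_recursion r rho _ (zeta 0%N) _ zeta (fun j => 2 * xi j + alpha * e j)) => //.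
    - by rewrite rho0.
    - by rewrite mulr_ge0.
    - by rewrite addr_ge0 ?mulr_ge0 // addr_ge0 // mulr_ge0.
    move=> j jk; have := X j (ltnW (leq_trans jk kn)).
    have := ler_wpM2l al0 (eV j (leq_trans jk kn)); lra.
  split; first exact: Y.
  have : p n <= (p 0%N + eta * B V / (r ^+ 2 - sigma)) * (r ^+ 2) ^+ n.
    apply: (@geometric_recursion (r ^+ 2) sigma _ (p 0%N) _ p
      (fun j => 4 * L ^+ 2 * xi j ^+ 2 + 2 * zeta j ^+ 2)) => //.
      by rewrite sg0.
    move=> k kn.
    have hx := sqr_le _ _ k (xi0 k) (X k (ltnW kn)).
    have hy := sqr_le _ _ k (zeta0 k) (Y k (ltnW kn)).
    have L4 : 0 <= 4 * L ^+ 2 by rewrite mulr_ge0 ?sqr_ge0.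
    by have := ler_wpM2l L4 hx; rewrite /B; lra.
  move/le_trans; apply; apply: ler_wpM2r; first by rewrite exprn_ge0 ?sqr_ge0.
  by rewrite lerD2l mulrAC; apply: ler_wpM2r.
(* [b] and [c] are the coefficients of [V] and of 1 in the bound on [c1 * p n + c2 * zeta n ^+ 2];
   they stem from the initial values. *)
pose b := 16 * gp * c1 * L ^+ 2 * a1 * k1 + 2 * (4 * gp * c1 + c2) * a2 * k2.
pose c := c1 * p 0%N + 8 * gp * c1 * L ^+ 2 * a1 ^+ 2 + (4 * gp * c1 + c2) * a2 ^+ 2.
have b0 : 0 <= b by rewrite /b; do ?[by []|exact: exprn_ge0|apply: addr_ge0|apply: mulr_ge0].
have c0 : 0 <= c by rewrite /c; do ?[by []|exact: exprn_ge0|apply: addr_ge0|apply: mulr_ge0].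
(* Large enough for [3 * (b * V + c) <= V ^+ 2], which is [VE]. *)
pose V := 4 * (b + c + 1).
have V0 : 0 <= V by rewrite /V; clearbody b c; lra.
have VE : 3 / 4 * (V ^+ 2 + b * V + c) <= V ^+ 2.
  have bc : 0 <= b * c by rewrite mulr_ge0.
  have bb : 0 <= b ^+ 2 by rewrite sqr_ge0.
  have cc : 0 <= c ^+ 2 by rewrite sqr_ge0.
  by rewrite /V; clearbody b c; lra.
have eV n : e n <= V * r ^+ n.
  elim/ltn_ind: n => n IH; have [Yn Pn] := bounds V n V0 IH.
  have Vr : 0 <= V * r ^+ n by apply: mulr_ge0 => //; rewrite exprn_ge0 // ltW.
  rewrite -(@ler_pXn2r _ 2) ?nnegrE //.
  apply: le_trans (He n) _.
  have zn0 : 0 <= (r ^+ 2) ^+ n by rewrite exprn_ge0 ?sqr_ge0.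
  have Y2 : zeta n ^+ 2 <= (a2 + k2 * V) ^+ 2 * (r ^+ 2) ^+ n.
    exact: sqr_le.
  have h1 := ler_wpM2l c10 Pn; have h2 := ler_wpM2l c20 Y2.
  rewrite exprMn (exprAC _ n).
  apply: le_trans (ler_wpM2r zn0 VE).
  have h3 : c1 * (p 0%N + 2 * gp * B V) + c2 * (a2 + k2 * V) ^+ 2 <=
      V ^+ 2 + b * V + c.
    have := ler_wpM2r (sqr_ge0 V) lead; rewrite /B /b /c; lra.
  have := ler_wpM2r zn0 h3; lra.
exists (p 0%N + 2 * gp * B V) => n.
by have [] := bounds V n V0 (fun k _ => eV k).
Qed.

(** Here [A1], [A2] and [A3] arise. With [t = r - rho <= 1], the square of [2 rho alpha + alpha t]
    is at most [8 rho^2 alpha^2 + 2 alpha^2]: the first part gives [A3], the second [A2], and the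
    direct effect of [xi] gives [A1]. *)
Lemma leading_coefficient (r rho alpha L c1 c2 gp : R) :
  0 <= rho < r -> r - rho <= 1 -> 0 <= L -> 0 <= alpha ->
  0 <= c1 -> 0 <= c2 -> 0 <= gp ->
  alpha ^+ 2 * (2 * gp * c1 * (4 * L ^+ 2 * rho ^+ 2)
    + (4 * gp * c1 + c2) * (2 * L ^+ 2 * rho ^+ 2)
    + (4 * gp * c1 + c2) * (8 * L ^+ 2 * rho ^+ 4)) <= (r - rho) ^+ 4 ->
  let k1 := rho * alpha / (r - rho) in
  let k2 := rho * L * (2 * k1 + alpha) / (r - rho) in
  8 * gp * c1 * L ^+ 2 * k1 ^+ 2 + (4 * gp * c1 + c2) * k2 ^+ 2 <= 1.
Proof.
have tE : exists t, t = r - rho by eexists.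
case: tE => t tE; rewrite -tE => /andP[rho0 rhor] t1 L0 al0 c10 c20 gp0 H.
cbv zeta; set k1 := rho * alpha / t; set k2 := rho * L * _ / t.
have t0 : 0 < t by rewrite tE subr_gt0.
have k1E : k1 * t = rho * alpha by rewrite divfK ?gt_eqF.
have k2E : k2 * t ^+ 2 = rho * L * (2 * (rho * alpha) + alpha * t).
  by rewrite /k2 /k1; field; rewrite gt_eqF.
clearbody k1 k2.
have t4 : 0 < t ^+ 4 by rewrite exprn_gt0.
rewrite -(ler_pM2r t4) mul1r; apply: le_trans _ H.
have -> : (8 * gp * c1 * L ^+ 2 * k1 ^+ 2 + (4 * gp * c1 + c2) * k2 ^+ 2) * t ^+ 4 =
    8 * gp * c1 * L ^+ 2 * (k1 * t) ^+ 2 * t ^+ 2 + (4 * gp * c1 + c2) * (k2 * t ^+ 2) ^+ 2.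
  by ring.
rewrite k1E k2E.
have tt : t ^+ 2 <= 1 by rewrite expr_le1 // ltW.
have g0 : 0 <= 4 * gp * c1 + c2 by rewrite addr_ge0 ?mulr_ge0.
have q1 : 8 * gp * c1 * L ^+ 2 * (rho * alpha) ^+ 2 * t ^+ 2 <=
    8 * gp * c1 * L ^+ 2 * (rho * alpha) ^+ 2.
  by rewrite ler_piMr // !mulr_ge0 ?sqr_ge0.
have q2 : (rho * L * (2 * (rho * alpha) + alpha * t)) ^+ 2 <=
    (rho * L) ^+ 2 * (8 * (rho * alpha) ^+ 2 + 2 * alpha ^+ 2).
  rewrite exprMn ler_wpM2l ?sqr_ge0 //.
  have := sqr_ge0 (2 * (rho * alpha) - alpha * t).
  have := ler_wpM2l (sqr_ge0 alpha) tt; lra.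
have := ler_wpM2l g0 q2; lra.
Qed.

End SmallGain.

(** * The two regimes of the rate *)

Section Rate.
Variable R : realType.

(** [alpha_star] is the square of the larger root [s] of [(rho + s sqrt A)^2 = 1 - J s^2]. The
    implication from [A = 0] to [rho = 0] secures the strict [rho < r] when [sqrt (a * A)]
    vanishes. *)
Lemma rate_root (mu Lmax Dmax mutmin Dlmin rho a : R) :
  let A := Ahalf mu Lmax Dmax mutmin Dlmin rho in
  let J := Jc mu Dmax mutmin in
  0 < J -> J <= 1 / 2 -> 0 <= rho <= 1 -> (A = 0 -> rho = 0) ->
  0 < a < 1 -> (A = 0 \/ a < (1 - rho) ^+ 2 / A) ->
  exists r, [/\ r ^+ 2 = rate mu Lmax Dmax mutmin Dlmin rho a,
    rho < r, r <= 1, a * A <= (r - rho) ^+ 2 & 1 - J * a <= r ^+ 2].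
Proof.
move=> A J J0 J12 /andP[rho0 rho1] A0rho /andP[a0 a1] Aa.
rewrite /rate -/J /alpha_star -/A -/J.
have A0 : 0 <= A by exact: sqrtr_ge0.
set s := Num.sqrt a; set SA := Num.sqrt A; set T := Num.sqrt (A + _).
have rho2 : rho ^+ 2 <= 1 by rewrite expr_le1.
have sE : s ^+ 2 = a by rewrite sqr_sqrtr // ltW.
have SAE : SA ^+ 2 = A by rewrite sqr_sqrtr.
have TE : T ^+ 2 = A + J * (1 - rho ^+ 2).
  by rewrite sqr_sqrtr // addr_ge0 // mulr_ge0 ?subr_ge0 // ltW.
have s0 : 0 < s by rewrite sqrtr_gt0.
have sge0 : 0 <= s by exact: ltW.
have SA0 : 0 <= SA by exact: sqrtr_ge0.
have T0 : 0 <= T by exact: sqrtr_ge0.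
have Nge0 : 0 <= A + J by rewrite addr_ge0 // ltW.
have N0 : 0 < A + J by rewrite ltr_wpDl.
have sqE : Num.sqrt (a * A) = s * SA by rewrite sqrtrM // ltW.
rewrite sqE.
have Ja : 0 < 1 - J * a by nra.
have TA : rho * SA <= T.
  rewrite -(@ler_pXn2r _ 2) ?nnegrE ?mulr_ge0 // exprMn SAE TE.
  have : 0 <= A * (1 - rho ^+ 2) by rewrite mulr_ge0 ?subr_ge0.
  have : 0 <= J * (1 - rho ^+ 2) by rewrite mulr_ge0 ?subr_ge0 // ltW.
  lra.
set q := (_ + T) / _.
have qE : (A + J) * q = T - rho * SA.
  by rewrite /q mulrC divfK ?gt_eqF // mulNr addrC.
have q0 : 0 <= q by rewrite -(pmulr_rge0 _ N0) qE subr_ge0.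
clearbody q.
(* Completing the square in [s]: the sign of the difference of the two rates becomes that of
   [s - q]. *)
have key : (A + J) * ((rho + s * SA) ^+ 2 - (1 - J * a)) =
    ((A + J) * s + rho * SA) ^+ 2 - T ^+ 2.
  by rewrite TE -sE; rewrite -[in LHS]SAE -[in RHS]SAE; ring.
case: ifPn => [aq|]; last rewrite -leNgt => qa.
- have sq : s <= q.
    by rewrite -(@ler_pXn2r _ 2) ?nnegrE // sE ltW.
  have le0 : (rho + s * SA) ^+ 2 <= 1 - J * a.
    rewrite -subr_le0 -(pmulr_rle0 _ N0) key subr_le0.
    have w1 : 0 <= (A + J) * s + rho * SA by rewrite addr_ge0 // mulr_ge0.
    rewrite ler_pXn2r ?nnegrE //.
    by have := ler_wpM2l (ltW N0) sq; rewrite qE; lra.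
  set r := Num.sqrt (1 - J * a).
  have rE : r ^+ 2 = 1 - J * a by rewrite sqr_sqrtr // ltW.
  have r0 : 0 < r by rewrite sqrtr_gt0.
  have rhor : rho + s * SA <= r.
    have w1 : 0 <= rho + s * SA by rewrite addr_ge0 // mulr_ge0.
    by rewrite -(@ler_pXn2r _ 2) ?nnegrE // ?rE // ltW.
  have rhor' : rho < r.
    have [A00|An0] := eqVneq A 0; first by rewrite A0rho.
    have : 0 < s * SA by rewrite mulr_gt0 // sqrtr_gt0 lt_def An0.
    lra.
  exists r; split=> //.
    rewrite -(@ler_pXn2r _ 2) ?nnegrE // ?(ltW r0) // rE expr1n; nra.
    have sSA : 0 <= s * SA by rewrite mulr_ge0.
    have rr : 0 <= r - rho by rewrite subr_ge0 ltW.
    by rewrite -sE -SAE -exprMn ler_pXn2r ?nnegrE //; lra.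
  by rewrite rE.
- have sq : q <= s.
    by rewrite -(@ler_pXn2r _ 2) ?nnegrE // sE.
  have ge0 : 1 - J * a <= (rho + s * SA) ^+ 2.
    rewrite -subr_ge0 -(pmulr_rge0 _ N0) key subr_ge0.
    have w1 : 0 <= (A + J) * s + rho * SA by rewrite addr_ge0 // mulr_ge0.
    rewrite ler_pXn2r ?nnegrE //.
    by have := ler_wpM2l (ltW N0) sq; rewrite qE; lra.
  (* With [A = 0] this rate would be 0, yet it is at least [1 - J * a > 0]. *)
  have [A00|An0] := eqVneq A 0.
    have := lt_le_trans Ja ge0.
    by rewrite (A0rho A00) add0r exprMn SAE A00 mulr0 ltxx.
  have Ap : 0 < A by rewrite lt_def An0.
  have SAp : 0 < s * SA by rewrite mulr_gt0 // sqrtr_gt0.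
  exists (rho + s * SA); split=> //.
  + by rewrite ltrDl.
  + case: Aa => [A00|]; first by rewrite A00 eqxx in An0.
    rewrite ltr_pdivlMr // -sE -SAE -exprMn => h.
    have : s * SA <= 1 - rho.
      by rewrite -(@ler_pXn2r _ 2) ?nnegrE ?subr_ge0 // ltW.
    lra.
  + by rewrite addrAC subrr add0r exprMn sE SAE.
Qed.

End Rate.

(** * The algorithm: invariants, error recursions and rate *)

Section Sonata.
Variables (R : realType) (m d : nat).
Notation V := 'rV[R]_d.
Variables (K : set V) (F G : V -> R) (gf : 'I_m -> V -> V) (HF : V -> 'M[R]_d)
  (psi : 'I_m -> V -> V -> R) (gpsi : 'I_m -> V -> V -> V)
  (Hpsi : 'I_m -> V -> V -> 'M[R]_d)
  (mu mut Dl D L : R) (W : 'M[R]_m) (rho alpha : R)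
  (x xhat y : nat -> 'I_m -> V).

Let gF (z : V) := mean (fun i => gf i z).
Let U z := F z + G z.
Let Us := inf [set U z | z in K].

Hypotheses (m0 : (0 < m)%N) (K0 : K !=set0) (clK : closed K)
  (cK : convex_setR K) (cG : convex_fun_on K G)
  (Fg : second_order K F gF HF) (mu0 : 0 < mu)
  (Fcont : forall z, K z -> {for z, continuous F})
  (Fmu : forall z, K z -> forall u, mu * dotp u u <= dotp (u *m HF z) u)
  (psig : forall i w, K w -> second_order K (psi i w) (gpsi i w) (Hpsi i w))
  (psi_self : forall i w, K w -> gpsi i w w = gf i w)
  (mut0 : 0 < mut)
  (psimut : forall i w, K w -> strongly_convex_fun_on K mut (psi i w))
  (HDl : forall i w z, K w -> K z -> forall u,
    Dl * dotp u u <= dotp (u *m (Hpsi i w z - HF z)) u)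
  (D0 : 0 <= D)
  (HD : forall i w z, K w -> K z -> forall u,
    `|dotp (u *m (Hpsi i w z - HF z)) u| <= D * dotp u u)
  (L0 : 0 <= L)
  (gfL : forall i p q, K p -> K q ->
    enorm (gf i p - gf i q) <= L * enorm (p - q))
  (W0 : forall i j, 0 <= W i j) (Wr : forall i, \sum_j W i j = 1)
  (Wc : forall j, \sum_i W i j = 1)
  (rho0 : 0 <= rho)
  (Wrho : forall w : 'rV[R]_m,
    dotp (w *m (deviation W)^T) (w *m (deviation W)^T) <= rho ^+ 2 * dotp w w)
  (alpha0 : 0 <= alpha) (alpha1 : alpha <= 1)
  (Kx0 : forall i, K (x 0%N i))
  (y0 : forall i, y 0%N i = gf i (x 0%N i))
  (xhat_min : forall n i, K (xhat n i) /\ forall z, K z ->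
     psi i (x n i) (xhat n i)
       + dotp (y n i - gf i (x n i)) (xhat n i - x n i) + G (xhat n i)
     <= psi i (x n i) z + dotp (y n i - gf i (x n i)) (z - x n i) + G z)
  (x_next : forall n i, x n.+1 i =
     mix W (fun j => x n j + alpha *: (xhat n j - x n j)) i)
  (y_next : forall n i, y n.+1 i =
     mix W (fun j => y n j + gf j (x n.+1 j) - gf j (x n j)) i).

Let step n i := xhat n i - x n i.
Let err n i := gF (x n i) - y n i.
Let mis n i := gF (x n i) - mean (y n).

Let alpha01 : 0 <= alpha <= 1. Proof. by rewrite alpha0. Qed.

Lemma xhat_in n i : K (xhat n i).
Proof. by have [] := xhat_min n i. Qed.

Lemma iterates_in n i : K (x n i).
Proof.
elim: n i => [//|n IH] i; rewrite x_next.
have cT : convex_fun_on K (fun _ : V => 0 : R) by move=> *; rewrite !mulr0 addr0.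
apply: (convex_comb_mem cK cT (W0 i) (Wr i) _).1 => j.
by apply: segment_mem => //; exact: xhat_in.
Qed.

(** The linear tracking term is moved into the convex part [G'], so that the smooth part is the
    surrogate alone. *)
Lemma xhat_optimal n i z : K z ->
  0 <= dotp (gpsi i (x n i) (xhat n i) + (y n i - gpsi i (x n i) (x n i)))
    (z - xhat n i) + G z - G (xhat n i).
Proof.
move=> Kz; have Kx := iterates_in n i; have [Kxh xh_min] := xhat_min n i.
rewrite psi_self //; set c := y n i - _.
pose G' z := G z + dotp c (z - x n i).
have cG' : convex_fun_on K G'.
  move=> p q t Kp Kq t01 Kw; rewrite /G'.
  have -> : (1 - t) *: p + t *: q - x n i = (1 - t) *: (p - x n i) + t *: (q - x n i).
    by apply/rowP => j; rewrite !mxE; ring.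
  by rewrite (dotpDr ((1 - t) *: _)) !dotpZr; have := cG Kp Kq t01 Kw; lra.
have [h1 _ _] := psig i Kx Kxh.
have xh_min' w : K w -> psi i (x n i) (xhat n i) + G' (xhat n i) <= psi i (x n i) w + G' w.
  by move=> /xh_min; rewrite /G' -/c; lra.
have := minimizer_variational_inequality cK cG' Kxh h1 xh_min' Kz.
rewrite /G' dotpDl !dotpBr; lra.
Qed.

(** Invariant of gradient tracking: mixing preserves the mean, the gradient increments telescope,
    and the initial choice of [y] starts it. *)
Lemma mean_tracking n : mean (y n) = mean (fun j => gf j (x n j)).
Proof.
elim: n => [|n IH]; first by congr (_ *: _); apply: eq_bigr => i _; rewrite y0.
have -> : y n.+1 = mix W (fun j => y n j + gf j (x n.+1 j) - gf j (x n j)).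
  by apply/funext => i; rewrite y_next.
rewrite (mean_mix Wc); move: IH; rewrite /mean sumrB big_split /=.
by rewrite !scalerBr !scalerDr => ->; rewrite addrAC subrr add0r.
Qed.

(** By tracking, [mis n i] is the average over [j] of [gf j (x n i) - gf j (x n j)]; Jensen and the
    Lipschitz bound reduce it to pairwise distances. *)
Lemma sum_mis n : \sum_i dotp (mis n i) (mis n i) <= 2 * L ^+ 2 * fnorm (perp (x n)) ^+ 2.
Proof.
have mi0 : 0 <= m%:R^-1 :> R by rewrite invr_ge0.
have misE i : dotp (mis n i) (mis n i) <=
    L ^+ 2 * (m%:R^-1 * \sum_j dotp (x n i - x n j) (x n i - x n j)).
  have -> : mis n i = \sum_j m%:R^-1 *: (gf j (x n i) - gf j (x n j)).
    by rewrite /mis /gF mean_tracking /mean -scaler_sumr -scalerBr sumrB.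
  have c2 : convex_fun_on setT (fun w : V => dotp w w).
    move=> p q t _ _ /andP[t0 t1] _; have := dotpp_ge0 (p - q).
    rewrite !(dotpBl, dotpBr, dotpDl, dotpDr, dotpZl, dotpZr) (dotpC q p) => h.
    have : 0 <= t * (1 - t) by rewrite mulr_ge0 // subr_ge0.
    by move=> /mulr_ge0 /(_ h); lra.
  have w1 : \sum_(j < m) m%:R^-1 = 1 :> R.
    by rewrite sumr_const card_ord -[_ *+ m]mulr_natr mulVf // pnatr_eq0 -lt0n.
  have cT : convex_setR (setT : set V) by [].
  have [_ H] := convex_comb_mem (z := fun j => gf j (x n i) - gf j (x n j))
    cT c2 (fun=> mi0) w1 (fun=> I).
  apply: le_trans H _; rewrite -mulr_sumr mulrCA.
  apply: ler_wpM2l => //; rewrite mulr_sumr; apply: ler_sum => j _.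
  rewrite -!sqr_enorm -exprMn ler_pXn2r ?nnegrE ?mulr_ge0 ?enorm_ge0 //.
  by apply: gfL; exact: iterates_in.
apply: le_trans (ler_sum _ (fun i _ => misE i)) _.
by rewrite -!mulr_sumr (sum_sqr_pairs m0); lra.
Qed.

Lemma err_mis n i : err n i = mis n i - perp (y n) i.
Proof. by rewrite /err /mis /perp opprB addrA subrK. Qed.

Lemma sum_err n : \sum_i dotp (err n i) (err n i) <=
  4 * L ^+ 2 * fnorm (perp (x n)) ^+ 2 + 2 * fnorm (perp (y n)) ^+ 2.
Proof.
have h i : dotp (err n i) (err n i) <=
    2 * dotp (mis n i) (mis n i) + 2 * dotp (perp (y n) i) (perp (y n) i).
  rewrite err_mis; move: (mis n i) (perp (y n) i) => p q.
  have := dotpp_ge0 (p + q).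
  by rewrite !(dotpBl, dotpBr, dotpDl, dotpDr) (dotpC q p); lra.
apply: le_trans (ler_sum _ (fun i _ => h i)) _.
rewrite big_split /= -!mulr_sumr -(sqr_fnorm (perp (y n))).
rewrite lerD2r; have := ler_wpM2l (ler0n R 2) (sum_mis n).
by rewrite !mulrA -natrM.
Qed.

Lemma perp_x_next n : fnorm (perp (x n.+1)) <=
  rho * fnorm (perp (x n)) + rho * alpha * fnorm (step n).
Proof.
have -> : x n.+1 = mix W (fun j => x n j + alpha *: step n j).
  by apply/funext => i; rewrite x_next.
rewrite perp_mix //.
have -> : mix (deviation W) (fun j => x n j + alpha *: step n j) =
    mix (deviation W) (fun j => perp (x n) j + alpha *: step n j).
  by apply/funext => i; rewrite (mixD _ (x n)) (mixD _ (perp (x n))) mix_deviation_perp.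
apply: le_trans (fnorm_mix _ rho0 Wrho) _.
rewrite -mulrA -mulrDr ler_wpM2l //; apply: le_trans (ler_fnormD _ _) _.
by rewrite lerD2l fnormZ.
Qed.

(** The mean cancels between the mixed and the old iterates. One consensus error comes from the
    mixed part, where [W] is nonexpansive, the other from the subtracted one. *)
Lemma x_increment n : fnorm (fun i => x n.+1 i - x n i) <=
  2 * fnorm (perp (x n)) + alpha * fnorm (step n).
Proof.
have -> : (fun i => x n.+1 i - x n i) =
    (fun i => mix W (fun j => perp (x n) j + alpha *: step n j) i - perp (x n) i).
  apply/funext => i; rewrite x_next (mixD _ (x n)) (mixD _ (perp (x n))) /perp mixB (mix_cst Wr).
  move: (mix W (x n) i) (mix _ _ i) (mean _) => a b c.
  by apply/rowP => k; rewrite !mxE; ring.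
apply: le_trans (ler_fnormB _ _) _.
have nonexp (w : 'rV[R]_m) : dotp (w *m W^T) (w *m W^T) <= 1 ^+ 2 * dotp w w.
  by rewrite expr1n mul1r stochastic_nonexpansive.
have h1 := fnorm_mix (fun j => perp (x n) j + alpha *: step n j) ler01 nonexp.
have h2 := ler_fnormD (perp (x n)) (fun j => alpha *: step n j).
have h3 := fnormZ (step n) alpha0; rewrite mul1r in h1.
apply: le_trans (lerD (le_trans h1 (le_trans h2 (lerD (lexx _) h3))) (lexx _)) _.
by rewrite mulr_natl mulr2n addrAC.
Qed.

Lemma perp_y_next n : fnorm (perp (y n.+1)) <= rho * fnorm (perp (y n))
  + rho * L * (2 * fnorm (perp (x n)) + alpha * fnorm (step n)).
Proof.
have -> : y n.+1 = mix W (fun j => y n j + (gf j (x n.+1 j) - gf j (x n j))).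
  by apply/funext => i; rewrite y_next; congr (mix _ _ _); apply/funext => j; rewrite addrA.
rewrite perp_mix //.
have -> : mix (deviation W) (fun j => y n j + (gf j (x n.+1 j) - gf j (x n j))) =
    mix (deviation W) (fun j => perp (y n) j + (gf j (x n.+1 j) - gf j (x n j))).
  by apply/funext => i; rewrite (mixD _ (y n)) (mixD _ (perp (y n))) mix_deviation_perp.
apply: le_trans (fnorm_mix _ rho0 Wrho) _.
rewrite -mulrA -mulrDr ler_wpM2l //; apply: le_trans (ler_fnormD _ _) _.
rewrite lerD2l; apply: le_trans (ler_wpM2l L0 (x_increment n)).
by apply: le_fnorm => // i; apply: gfL; exact: iterates_in.
Qed.

(** The gap inequality of one agent at time 0 holds for all [z] in [K] with the same right-hand
    side. *)
Lemma U_lower_bounded : has_lbound [set U z | z in K].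
Proof.
pose i := Ordinal m0; have Kx := iterates_in 0 i.
exists (U (xhat 0%N i) - (D * enorm (step 0%N i) + enorm (err 0%N i)) ^+ 2 / (2 * mu)).
move=> _ [z Kz <-].
have := local_gap cK Fg (psig i Kx) mu0 Fmu D0 (fun z Kz => HD i Kx Kz) Kx
  (xhat_in 0 i) (xhat_optimal 0 i) Kz.
by rewrite /U /step /err; lra.
Qed.

Lemma Us_le z : K z -> Us <= U z.
Proof. by move=> Kz; apply: ge_inf; [exact: U_lower_bounded|exists z]. Qed.

Lemma xhat_gap n i : U (xhat n i) - Us <=
  (D * enorm (step n i) + enorm (err n i)) ^+ 2 / (2 * mu).
Proof.
have Kx := iterates_in n i.
rewrite lerBlDr -lerBlDl; apply: lb_le_inf.
  by case: K0 => z Kz; exists (U z), z.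
move=> _ [z Kz <-].
have := local_gap cK Fg (psig i Kx) mu0 Fmu D0 (fun z Kz => HD i Kx Kz) Kx
  (xhat_in n i) (xhat_optimal n i) Kz.
by rewrite /U /step /err; lra.
Qed.

Let s := (1 - alpha / 2) * mut + Dl / 2 * alpha.

(** Convexity of [U] and unit column sums show that mixing does not increase the total gap, so the
    contraction can be proved agent by agent before mixing. *)
Lemma gap_next n : 0 < s ->
  \sum_i (U (x n.+1 i) - Us) <=
    (1 - alpha * (s * mu / (2 * D ^+ 2 + s * mu))) * \sum_i (U (x n i) - Us)
    + alpha * ((D ^+ 2 / s + s) / (2 * D ^+ 2 + s * mu)) *
      \sum_i dotp (err n i) (err n i).
Proof.
move=> s0.
have cU : convex_fun_on K U.
  have Fsc := second_order_strongly_convex cK Fg Fmu.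
  move=> p q t Kp Kq t01 Kw; have := Fsc _ _ _ Kp Kq t01 Kw.
  have := cG Kp Kq t01 Kw; have := sqr_ge0 (enorm (p - q)).
  move: t01 => /andP[t0 t1].
  have : 0 <= mu / 2 * t * (1 - t) by rewrite !mulr_ge0 ?subr_ge0 // ltW.
  by move=> h1 h2; have := mulr_ge0 h1 h2; rewrite /U; lra.
have Kh i : K (x n i + alpha *: step n i).
  by apply: segment_mem => //; [exact: iterates_in|exact: xhat_in].
apply: (@le_trans _ _ (\sum_i (U (x n i + alpha *: step n i) - Us))).
  rewrite !sumrB lerD2r.
  apply: (@le_trans _ _ (\sum_i \sum_j W i j * U (x n j + alpha *: step n j))).
    apply: ler_sum => i _; rewrite x_next.
    exact: (convex_comb_mem cK cU (W0 i) (Wr i) Kh).2.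
  rewrite exchange_big /=; apply: ler_sum => j _.
  by rewrite -mulr_suml Wc mul1r.
rewrite !mulr_sumr -big_split /=; apply: ler_sum => i _.
have Kx := iterates_in n i.
rewrite -sqr_enorm; apply: (@step_contraction R alpha s D mu _ _ (enorm (step n i))) => //.
  have := local_descent cK cG Fg (psig i Kx) (psimut i Kx)
    (fun z Kz => HDl i Kx Kz) Kx (xhat_in n i) (xhat_optimal n i) alpha01.
  have := ler_wpM2l alpha0 (dotp_le_enorm (err n i) (step n i)).
  by rewrite -sqr_enorm /U /step /err -/s; lra.
have h := ler_wpM2l alpha0 (xhat_gap n i).
apply: (@le_trans _ _ ((1 - alpha) * (U (x n i) - Us) + alpha * (U (xhat n i) - Us))).
  have Kw := Kh i.
  have E : x n i + alpha *: step n i = (1 - alpha) *: x n i + alpha *: xhat n i.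
    by apply/rowP => j; rewrite !mxE; ring.
  rewrite E in Kw *; have := cU _ _ _ Kx (xhat_in n i) alpha01 Kw; lra.
lra.
Qed.

(* Weights 4/9, 2/9, 1/3 in (a + b + c)^2 <= 9/4 a^2 + 9/2 b^2 + 3 c^2 leave
   the factor 3/4 < 1 with respect to the constants [C1] and [C2]. *)
Lemma step_bound n : fnorm (step n) ^+ 2 <=
  3 / 4 * (6 / mu * ((D / mut + 1) ^+ 2 + 4 * L ^+ 2 / mut ^+ 2)
             * \sum_i (U (x n i) - Us)
           + 4 / mut ^+ 2 * fnorm (perp (y n)) ^+ 2).
Proof.
have [xb [Gb [Kxb xb_dist xb_opt xb_lim]]] :=
  generalized_minimizer K0 clK cK Fg Fcont mu0 Fmu cG U_lower_bounded.
set k := D / mut + 1.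
have k0 : 0 <= k by rewrite addr_ge0 // divr_ge0 // ltW.
have mi0 : 0 <= mut^-1 by rewrite invr_ge0 ltW.
have agent i : dotp (step n i) (step n i) <=
    9 / 4 * k ^+ 2 * dotp (x n i - xb) (x n i - xb)
    + 9 / 2 * (mut^-1) ^+ 2 * dotp (mis n i) (mis n i)
    + 3 * (mut^-1) ^+ 2 * dotp (perp (y n) i) (perp (y n) i).
  have Kx := iterates_in n i.
  have h1 := local_distance cK Fg (psig i Kx) (psimut i Kx) D0
    (fun z Kz => HD i Kx Kz) Kx (xhat_in n i) (xhat_optimal n i) Kxb xb_opt xb_lim.
  have h2 : enorm (err n i) <= enorm (mis n i) + enorm (perp (y n) i).
    by rewrite err_mis ler_enormB.
  have h3 : enorm (step n i) <= enorm (xhat n i - xb) + enorm (x n i - xb).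
    by rewrite /step (_ : _ - x n i = (xhat n i - xb) - (x n i - xb)) ?ler_enormB //
      opprB addrA subrK.
  have h4 : enorm (step n i) <= k * enorm (x n i - xb) + mut^-1 * enorm (mis n i)
      + mut^-1 * enorm (perp (y n) i).
    have h1' : enorm (xhat n i - xb) <= mut^-1 *
        (D * enorm (x n i - xb) + (enorm (mis n i) + enorm (perp (y n) i))).
      by rewrite ler_pdivlMl //; apply: le_trans h1 _; rewrite lerD2l.
    by rewrite /k; lra.
  rewrite -!sqr_enorm; move: h4.
  set q := enorm (step n i); set q1 := k * _; set q2 := mut^-1 * _; set q3 := mut^-1 * _ => h4.
  have q0 : 0 <= q by exact: enorm_ge0.
  have h5 : q ^+ 2 <= (q1 + q2 + q3) ^+ 2.
    by rewrite ler_pXn2r ?nnegrE // (le_trans q0).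
  rewrite (_ : _ + _ + _ = 9 / 4 * q1 ^+ 2 + 9 / 2 * q2 ^+ 2 + 3 * q3 ^+ 2);
    last by rewrite /q1 /q2 /q3 !exprMn !mulrA.
  have := sqr_ge0 (q1 - 2 * q2); have := sqr_ge0 (3 * q1 - 4 * q3).
  have := sqr_ge0 (3 * q2 - 2 * q3); lra.
set P := \sum_i (U (x n i) - Us).
rewrite sqr_fnorm; apply: le_trans (ler_sum _ (fun i _ => agent i)) _.
rewrite !big_split /= -!mulr_sumr -(sqr_fnorm (perp (y n))).
set X := \sum_i dotp (x n i - xb) (x n i - xb).
have hX : mu * X <= 2 * P.
  have : mu / 2 * X <= P.
    rewrite mulr_sumr; apply: ler_sum => i _.
    by apply: xb_dist; exact: iterates_in.
  lra.
(* The consensus error is at most the distance to the constant family [xb], hence absorbed by the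
   gap: this yields the term [4 L^2 / mut^2] of [C1]. *)
have hM : \sum_i dotp (mis n i) (mis n i) <= 2 * L ^+ 2 * X.
  apply: le_trans (sum_mis n) _; rewrite ler_wpM2l ?mulr_ge0 ?sqr_ge0 //.
  exact: fnorm_perp_le.
have hX' : X <= 2 * P / mu by rewrite ler_pdivlMr // mulrC.
have g0 : 0 <= 9 / 2 * mut^-1 ^+ 2 by rewrite mulr_ge0 ?sqr_ge0.
have hM' := ler_wpM2l g0 hM.
have c0 : 0 <= 9 / 4 * k ^+ 2 + 9 * mut^-1 ^+ 2 * L ^+ 2.
  by rewrite addr_ge0 ?mulr_ge0 ?sqr_ge0.
have hX2 := ler_wpM2l c0 hX'.
have -> : 4 * L ^+ 2 / mut ^+ 2 = 4 * L ^+ 2 * mut^-1 ^+ 2 by rewrite exprVn.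
have -> : 4 / mut ^+ 2 = 4 * mut^-1 ^+ 2 by rewrite exprVn.
by rewrite -/k; lra.
Qed.

Lemma sonata_rate (r gp : R) : 0 < alpha -> 0 < s -> rho < r -> r <= 1 ->
  (D ^+ 2 / s ^+ 2 + 1) / mu <= gp ->
  1 - s * mu / (2 * D ^+ 2 + s * mu) / 2 * alpha <= r ^+ 2 ->
  let c1 := 6 / mu * ((D / mut + 1) ^+ 2 + 4 * L ^+ 2 / mut ^+ 2) in
  let c2 := 4 / mut ^+ 2 in
  alpha ^+ 2 * (2 * gp * c1 * (4 * L ^+ 2 * rho ^+ 2)
    + (4 * gp * c1 + c2) * (2 * L ^+ 2 * rho ^+ 2)
    + (4 * gp * c1 + c2) * (8 * L ^+ 2 * rho ^+ 4)) <= (r - rho) ^+ 4 ->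
  forall i, exists C, forall n, `|U (x n i) - Us| <= C * (r ^+ 2) ^+ n.
Proof.
move=> al0 s0 rhor r1 gpE rE c1 c2 lead i.
set N := 2 * D ^+ 2 + s * mu in rE.
have sm0 : 0 < s * mu by rewrite mulr_gt0.
have N0 : 0 < N by rewrite ltr_wpDl // mulr_ge0 ?sqr_ge0.
set kap := s * mu / N in rE.
have kap0 : 0 < kap by rewrite divr_gt0.
have kap1 : kap <= 1.
  by rewrite ler_pdivrMr // mul1r lerDr mulr_ge0 ?sqr_ge0.
have ak0 : 0 < alpha * kap by rewrite mulr_gt0.
have ak1 : alpha * kap <= 1 by rewrite mulr_ile1 // ltW.
set h := (D ^+ 2 / s + s) / N.
have h0 : 0 <= h.
  by apply: divr_ge0; [rewrite addr_ge0 ?divr_ge0 ?sqr_ge0 //; exact: ltW|exact: ltW].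
have gp0 : 0 <= gp.
  apply: le_trans gpE; apply: divr_ge0; last exact: ltW.
  by rewrite addr_ge0 // divr_ge0 ?sqr_ge0.
have c10 : 0 <= c1.
  apply: mulr_ge0; first by rewrite divr_ge0 // ltW.
  by rewrite addr_ge0 ?sqr_ge0 // divr_ge0 ?sqr_ge0 // mulr_ge0 ?sqr_ge0.
have c20 : 0 <= c2 by rewrite divr_ge0 ?sqr_ge0.
(* [h / kap] equals [(D^2 / s^2 + 1) / mu], the value of [GP] at [alpha]; the factor 2 is the price
   of spending only half of [kap]. *)
have eta_gp : alpha * h / (r ^+ 2 - (1 - alpha * kap)) <= 2 * gp.
  have dn : alpha * kap / 2 <= r ^+ 2 - (1 - alpha * kap) by lra.
  have dp : 0 < r ^+ 2 - (1 - alpha * kap) by apply: lt_le_trans dn; rewrite divr_gt0.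
  rewrite ler_pdivrMr //; apply: (@le_trans _ _ (2 * gp * (alpha * kap / 2))).
    have hE : h = kap * ((D ^+ 2 / s ^+ 2 + 1) / mu).
      by rewrite /h /kap; field; rewrite !gt_eqF.
    have -> : 2 * gp * (alpha * kap / 2) = alpha * kap * gp by field.
    by rewrite hE mulrA ler_wpM2l // ltW.
  by rewrite ler_wpM2l // mulr_ge0.
have rho0r : 0 <= rho < r by rewrite rho0.
have sgr : 0 <= 1 - alpha * kap < r ^+ 2.
  by rewrite subr_ge0 ak1 /=; apply: lt_le_trans rE; lra.
have t1 : r - rho <= 1 by lra.
have lead1 := leading_coefficient rho0r t1 L0 alpha0 c10 c20 gp0 lead.
have gap0 n j : 0 <= U (x n j) - Us by rewrite subr_ge0 Us_le //; exact: iterates_in.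
have gapn n : \sum_j (U (x n.+1 j) - Us) <= (1 - alpha * kap) * \sum_j (U (x n j) - Us)
    + alpha * h * (4 * L ^+ 2 * fnorm (perp (x n)) ^+ 2 + 2 * fnorm (perp (y n)) ^+ 2).
  apply: le_trans (gap_next n s0) _; rewrite lerD2l.
  by apply: ler_wpM2l; [exact: mulr_ge0|exact: sum_err].
have [C HC] := @small_gain R r rho alpha L (1 - alpha * kap) (alpha * h) c1 c2 gp
  (fun n => fnorm (perp (x n))) (fun n => fnorm (perp (y n)))
  (fun n => \sum_j (U (x n j) - Us)) (fun n => fnorm (step n))
  rho0r sgr alpha0 L0 (mulr_ge0 alpha0 h0) c10 c20 gp0 eta_gp lead1
  (fun n => fnorm_ge0 _) (fun n => fnorm_ge0 _)
  (fun n => sumr_ge0 _ (fun j _ => gap0 n j)) (fun n => fnorm_ge0 _)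
  perp_x_next perp_y_next gapn step_bound.
exists C => n; rewrite ger0_norm //; apply: le_trans (HC n).
by rewrite (bigD1 i) //= lerDl sumr_ge0.
Qed.

End Sonata.

(** * Minima and maxima of finite families *)

Section Extrema.
Variables (R : realType) (m : nat).
Implicit Types a : 'I_m -> R.

Lemma minf_le a i : minf a <= a i.
Proof.
rewrite /minf; have : a i \in [seq a i | i <- enum 'I_m] by rewrite map_f ?mem_enum.
case: [seq a i | i <- enum 'I_m] => // x s; rewrite inE /=.
elim: s => [|y s IH] /=; first by rewrite orbF => /eqP ->.
rewrite inE ge_min => /or3P[xi|/eqP ->|si]; last 1 first.
- by rewrite IH ?si ?orbT.
- by rewrite IH ?xi ?orbT.
- by rewrite lexx.
Qed.

Lemma maxf_ge a i : a i <= maxf a.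
Proof.
rewrite /maxf; have : a i \in [seq a i | i <- enum 'I_m] by rewrite map_f ?mem_enum.
case: [seq a i | i <- enum 'I_m] => // x s; rewrite inE /=.
elim: s => [|y s IH] /=; first by rewrite orbF => /eqP ->.
rewrite inE le_max => /or3P[xi|/eqP ->|si]; last 1 first.
- by rewrite IH ?si ?orbT.
- by rewrite IH ?xi ?orbT.
- by rewrite lexx.
Qed.

Lemma minf_gt0 a : (0 < m)%N -> (forall i, 0 < a i) -> 0 < minf a.
Proof.
move=> m0 a0; rewrite /minf.
have : all (fun x => 0 < x) [seq a i | i <- enum 'I_m].
  by apply/allP => x /mapP[i _ ->].
have : size [seq a i | i <- enum 'I_m] != 0%N by rewrite size_map size_enum_ord -lt0n.
case: [seq a i | i <- enum 'I_m] => // x s _ /= /andP[x0].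
by elim: s => [//|y s IH] /= /andP[y0 /IH s0]; rewrite lt_min y0.
Qed.

End Extrema.

(** * Bounds on the constants for admissible step-sizes *)

Section Constants.
Variable R : realType.
Implicit Types (mu D mt Dl a t : R).

Lemma GP_eq mu D mt Dl a : 0 < mu -> 0 < sP mt Dl a ->
  GP mu D mt Dl a = (D ^+ 2 / sP mt Dl a ^+ 2 + 1) / mu.
Proof. by move=> mu0; rewrite /GP; move: (sP _ _ _) => t t0; field; rewrite !gt_eqF. Qed.

(** [sP] is affine and nonincreasing in the step-size, and [abar] is where it reaches [mt / 2]; [GP]
    decreases as [sP] grows. If [mt = Dl], [sP] is constant. *)
Lemma sP_bounds mu D mt Dl a : 0 < mu -> 0 < mt -> Dl <= mt -> 0 < a < 1 ->
  (mt = Dl \/ a < abar mt Dl) ->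
  mt / 2 <= sP mt Dl a /\ (D ^+ 2 / sP mt Dl a ^+ 2 + 1) / mu <= GPbar mu D mt Dl.
Proof.
move=> mu0 mt0 Dlm /andP[a0 a1] abarE; rewrite /GPbar.
have [E|NE] := eqVneq mt Dl.
  have sE b : sP mt Dl b = mt by rewrite /sP -E; lra.
  by rewrite GP_eq ?sE //; split=> //; lra.
have dm : 0 < mt - Dl by rewrite subr_gt0 lt_def NE.
have sE : sP mt Dl (abar mt Dl) = mt / 2.
  by rewrite /sP /abar; field; rewrite gt_eqF.
have sl : mt / 2 <= sP mt Dl a.
  case: abarE => [E|]; first by rewrite E eqxx in NE.
  by rewrite /abar ltr_pdivlMr // /sP => h; lra.
split=> //; have m2 : 0 < mt / 2 by rewrite divr_gt0.
rewrite GP_eq ?sE //.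
have sp : 0 < sP mt Dl a by exact: lt_le_trans sl.
apply: ler_wpM2r; first by rewrite invr_ge0 ltW.
rewrite lerD2r ler_wpM2l ?sqr_ge0 //.
by rewrite lef_pV2 ?posrE ?exprn_gt0 // ler_pXn2r ?nnegrE // ltW.
Qed.

End Constants.

(** * Application to the data of the statement *)

(** A derivative of the slice along [v] is the joint derivative along [(v, 0)], so both orders
    follow by composing with the affine map from [v] to [(v, w)]. *)
Lemma twice_diff_slice (R : realType) (d : nat) (O : set 'rV[R]_d)
    (h : 'rV[R]_d -> 'rV[R]_d -> R) (w : 'rV[R]_d) :
  C2_fun_on (O `*` O) (fun p => h p.1 p.2) -> O w ->
  twice_diff_fun_on O (fun v => h v w).
Proof.
move=> [hd _] Ow x Ox.
have pd : differentiable (fun v : 'rV[R]_d => (v, w)) x.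
  by apply: (@differentiable_pair R _ _ _ id (cst w) x).
have E v y : derive (fun v => h v w) y v = derive (fun p => h p.1 p.2) (y, w) (v, 0).
  rewrite /derive; set q1 := (X in X @ _); set q2 := (X in _ = lim (X @ _)).
  suff -> : q1 = q2 by [].
  by apply/funext => t; rewrite /q1 /q2 /= scaler0 add0r.
have [h1 h2] := hd (x, w) (conj Ox Ow); split=> [|j].
  exact: (@differentiable_comp _ _ _ _ (fun v => (v, w)) (fun p => h p.1 p.2)).
under eq_fun do rewrite E.
exact: (@differentiable_comp _ _ _ _ (fun v => (v, w))
  (fun p => derive (fun p => h p.1 p.2) p (ebase R j, 0))).
Qed.

Unset Implicit Arguments.

Theorem theorem3p10 (R : realType) (m d : nat) (hm : (0 < m)%N)
  (K O : set 'rV[R]_d) (f : 'I_m -> 'rV[R]_d -> R) (G : 'rV[R]_d -> R)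
  (mu L : R) (Li : 'I_m -> R)
  (E : rel 'I_m) (W : 'M[R]_m) (rho : R)
  (ft : 'I_m -> 'rV[R]_d -> 'rV[R]_d -> R) (mut Lt Dl Du : 'I_m -> R)
  (alpha : R) (x xhat y : nat -> 'I_m -> 'rV[R]_d) :
  (* Assumption (A) *)
  K !=set0 -> closed K -> convex_setR K ->
  open O -> K `<=` O ->
  (forall i, twice_diff_fun_on O (f i) /\ convex_fun_on O (f i)) ->
  0 < mu ->
  (forall z, K z -> loewner_le (mu%:M) (hess (avgF f) z) /\
                    loewner_le (hess (avgF f) z) (L%:M)) ->
  convex_fun_on K G ->
  (forall i z, K z -> loewner_le (hess (f i) z) ((Li i)%:M)) ->
  (* Assumptions (B) and (W) *)
  connected_graph E -> weights_ok E W ->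
  largest_singular_value (consensus_matrix m d W) rho ->
  (* Assumption (C) *)
  (forall i, C2_fun_on (O `*` O) (fun p => ft i p.1 p.2)) ->
  (forall i z, K z -> grad (fun w => ft i w z) z = grad (f i) z) ->
  (forall i z, K z -> grad_lipschitz_on K (Lt i) (grad (fun w => ft i w z))) ->
  (forall i, 0 < mut i) ->
  (forall i z, K z -> strongly_convex_fun_on K (mut i) (fun w => ft i w z)) ->
  (forall i, Dl i <= Du i) ->
  (forall i z w, K z -> K w ->
     loewner_le ((Dl i)%:M) (hess (fun v => ft i v w) z - hess (avgF f) z) /\
     loewner_le (hess (fun v => ft i v w) z - hess (avgF f) z) ((Du i)%:M)) ->
  let mutmin := minf mut in
  let Dlmin := minf Dl in
  let Dmax := maxf (fun i => Num.max `|Dl i| `|Du i|) in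
  let Lmax := maxf Li in
  Dlmin <= mutmin ->
  (* SONATA run with step-size alpha *)
  sonata K G f ft W alpha x xhat y ->
  0 < alpha -> below_alpha_max mu Lmax Dmax mutmin Dlmin rho alpha ->
  let U := fun z => avgF f z + G z in
  let Ustar := inf [set U z | z in K] in
  let z := rate mu Lmax Dmax mutmin Dlmin rho alpha in
  forall i, exists C : R, exists N : nat, forall nu : nat, (N <= nu)%N ->
    `|U (x nu i) - Ustar| <= C * z ^+ nu.
Proof.
move=> K0 clK cK oO KO Hf mu0 HF cG HLi _ Wok rhoE Hft Hself _ mut0 Hsc _ HD.
move=> mutmin Dlmin Dmax Lmax Dlm [Kx0 [y0 [xhat_min [x_next y_next]]]] al0.
move=> [Aal [abarE al1]] U Ustar z.
have W0 := weights_ok_ge0 Wok; case: (Wok) => _ [_ [_ [Wr Wc]]].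
have [d0 rho01 Wrho] := consensus_contraction hm W0 Wr Wc rhoE.
have rho0 : 0 <= rho by case/andP: rho01.
have fg i := second_order_twice_diff oO (Hf i).1.
have FO := second_order_mean fg.
have Funiq := second_order_unique oO FO.
have Fg := second_order_sub KO FO.
set HFm := (fun x : 'rV[R]_d => _ *: \sum_i hess (f i) x) in FO Funiq Fg.
have Fmu w : K w -> forall u, mu * dotp u u <= dotp (u *m HFm w) u.
  move=> Kw u; have [h _] := HF w Kw.
  have := h u; rewrite (Funiq w (KO w Kw)).2 mul_mx_scalar dotpZl; exact.
have minmut0 : 0 < mutmin by exact: minf_gt0.
have LiE i : Li i <= Lmax by exact: maxf_ge.
have hess_le i w u : K w -> dotp (u *m hess (f i) w) u <= Lmax * dotp u u.
  move=> Kw; have := HLi i w Kw u; rewrite mul_mx_scalar dotpZl => /le_trans; apply.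
  by rewrite ler_wpM2r ?dotpp_ge0.
(* Strictness matters below: it makes the factor of [rho ^+ 2] in [A1] positive. A unit vector
   exists because [0 < d]. *)
have Lmax0 : 0 < Lmax.
  case: K0 => w Kw; apply: lt_le_trans mu0 _.
  set u := ebase R (Ordinal d0).
  have uu : dotp u u = 1 by rewrite dotp_ebase mxE !eqxx.
  have := Fmu w Kw u; rewrite uu mulr1 => /le_trans; apply.
  rewrite /HFm -scalemxAr mulmx_sumr dotpZl dotp_suml.
  rewrite ler_pdivrMl ?ltr0n //.
  apply: (@le_trans _ _ (\sum_(i < m) Lmax)).
    by apply: ler_sum => i _; have := hess_le i w u Kw; rewrite uu mulr1.
  by rewrite sumr_const card_ord -[_ *+ m]mulr_natl.
have gfL i p q : K p -> K q ->
    enorm (grad (f i) p - grad (f i) q) <= Lmax * enorm (p - q).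
  move=> Kp Kq.
  apply: (gradient_lipschitz (ltW Lmax0) cK (second_order_sub KO (fg i)) _ Kq Kp).
  move=> w Kw u v; apply: symmetric_form_bound => [u' v'|u'].
    by have [] := fg i w (KO w Kw).
  (* The assumption bounds the Hessian only from above; convexity supplies the other side. *)
  rewrite ger0_norm ?hess_le //.
  exact: (hess_psd _ oO (KO w Kw) (Hf i).1 (Hf i).2).
have Fcont w : K w -> {for w, continuous (avgF f)}.
  move=> Kw; apply: differentiable_continuous.
  have -> : avgF f = m%:R^-1 *: \sum_i f i.
    by apply/funext => v; rewrite /avgF; congr (_ * _); rewrite fct_sumE.
  apply: differentiableZ; apply: differentiable_sum => i.
  by have [] := (Hf i).1 w (KO w Kw).
have psig i w (Kw : K w) : second_order K (fun v => ft i v w)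
    (grad (fun v => ft i v w)) (hess (fun v => ft i v w)).
  apply: (second_order_sub KO (second_order_twice_diff oO _)).
  exact: (twice_diff_slice (Hft i) (KO w Kw)).
have psimut i w : K w -> strongly_convex_fun_on K mutmin (fun v => ft i v w).
  move=> Kw p q t Kp Kq t01 Kpq; apply: le_trans (Hsc i w Kw p q t Kp Kq t01 Kpq) _.
  rewrite lerD2l lerN2 -!mulrA; apply: ler_pM => //.
  - exact: ltW.
  - case/andP: t01 => t0 t1; apply: mulr_ge0 => //; apply: mulr_ge0 => //.
    by rewrite mulr_ge0 ?sqr_ge0 ?subr_ge0.
  - exact: minf_le.
have HDq i w v u : K w -> K v ->
    Dl i * dotp u u <= dotp (u *m (hess (fun v => ft i v w) v - HFm v)) u /\
    dotp (u *m (hess (fun v => ft i v w) v - HFm v)) u <= Du i * dotp u u.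
  move=> Kw Kv; have [h1 h2] := HD i v w Kv Kw.
  have := h1 u; have := h2 u.
  by rewrite (Funiq v (KO v Kv)).2 !mul_mx_scalar !dotpZl.
have HDl i w v : K w -> K v -> forall u,
    Dlmin * dotp u u <= dotp (u *m (hess (fun v => ft i v w) v - HFm v)) u.
  move=> Kw Kv u; apply: le_trans (HDq i w v u Kw Kv).1.
  by apply: ler_wpM2r; [exact: dotpp_ge0|exact: minf_le].
have DmaxE i : Num.max `|Dl i| `|Du i| <= Dmax.
  exact: (maxf_ge (fun i => Num.max `|Dl i| `|Du i|)).
have HDabs i w v : K w -> K v -> forall u,
    `|dotp (u *m (hess (fun v => ft i v w) v - HFm v)) u| <= Dmax * dotp u u.
  move=> Kw Kv u; have [h1 h2] := HDq i w v u Kw Kv.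
  have := DmaxE i; rewrite ge_max => /andP[a1 a2].
  have a1' : - Dl i <= Dmax by apply: le_trans a1; rewrite -normrN ler_norm.
  have b1 := ler_wpM2r (dotpp_ge0 u) a1'.
  have b2 := ler_wpM2r (dotpp_ge0 u) (le_trans (ler_norm _) a2).
  by rewrite ler_norml; apply/andP; split; lra.
have Dmax0 : 0 <= Dmax.
  by apply: le_trans (DmaxE (Ordinal hm)); rewrite le_max normr_ge0.
have al01 : 0 < alpha < 1 by rewrite al0.
have [sl gpE] := sP_bounds Dmax mu0 minmut0 Dlm al01 abarE.
set s := sP mutmin Dlmin alpha in sl gpE.
set gp := GPbar mu Dmax mutmin Dlmin in gpE.
have s0 : 0 < s by apply: lt_le_trans sl; rewrite divr_gt0.
have gp0 : 0 < gp.
  apply: lt_le_trans gpE; rewrite divr_gt0 // ltr_wpDl //.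
  by rewrite divr_ge0 ?sqr_ge0.
have c10 : 0 < C1 mu Lmax Dmax mutmin.
  rewrite /C1 mulr_gt0 ?divr_gt0 // ltr_wpDr //.
    by rewrite divr_ge0 ?sqr_ge0 // mulr_ge0 ?sqr_ge0.
  by rewrite exprn_gt0 // ltr_wpDl // divr_ge0 // ltW.
have gpge := ltW gp0; have c1ge := ltW c10.
have c20 : 0 <= C2 mutmin by rewrite /C2 divr_ge0 ?sqr_ge0.
set A := Ahalf mu Lmax Dmax mutmin Dlmin rho in Aal.
set S := A1 mu Lmax Dmax mutmin Dlmin rho + A2 mu Lmax Dmax mutmin Dlmin rho
  + A3 mu Lmax Dmax mutmin Dlmin rho.
have g0 : 0 <= 4 * gp * C1 mu Lmax Dmax mutmin + C2 mutmin.
  by apply: addr_ge0 => //; apply: mulr_ge0 => //; apply: mulr_ge0.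
have A20 : 0 <= A2 mu Lmax Dmax mutmin Dlmin rho.
  by rewrite /A2 -/gp; apply: mulr_ge0 => //; rewrite mulr_ge0 ?sqr_ge0 // mulr_ge0 ?sqr_ge0.
have A30 : 0 <= A3 mu Lmax Dmax mutmin Dlmin rho.
  by rewrite /A3 -/gp; apply: mulr_ge0 => //; rewrite mulr_ge0 ?exprn_ge0 // mulr_ge0 ?sqr_ge0.
have A10 : 0 <= A1 mu Lmax Dmax mutmin Dlmin rho.
  rewrite /A1 -/gp; apply: mulr_ge0.
    by apply: mulr_ge0 => //; apply: mulr_ge0.
  by rewrite mulr_ge0 ?sqr_ge0 // mulr_ge0 ?sqr_ge0.
have S0 : 0 <= S by apply: addr_ge0 => //; apply: addr_ge0.
have AS : A ^+ 2 = S by rewrite sqr_sqrtr.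
have A0rho : A = 0 -> rho = 0.
  move=> A0; have : A1 mu Lmax Dmax mutmin Dlmin rho <= 0.
    by move: AS; rewrite A0 expr0n /= /S; lra.
  have q0 : 0 < 2 * gp * C1 mu Lmax Dmax mutmin * (4 * Lmax ^+ 2).
    apply: mulr_gt0; last by rewrite mulr_gt0 // exprn_gt0.
    by apply: mulr_gt0 => //; apply: mulr_gt0.
  rewrite /A1 -/gp mulrA pmulr_rle0 // => r2.
  by apply/eqP; rewrite -sqrf_eq0 eq_le r2 sqr_ge0.
set J := Jc mu Dmax mutmin.
have mm0 : 0 < mutmin * mu by rewrite mulr_gt0.
have den0 : 0 < 4 * Dmax ^+ 2 + mutmin * mu by rewrite ltr_wpDl // mulr_ge0 ?sqr_ge0.
have J0 : 0 < J by rewrite /J /Jc mulr_gt0 // divr_gt0.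
have J12 : J <= 1 / 2.
  rewrite /J /Jc; apply: ler_piMr; first by rewrite divr_ge0.
  by rewrite ler_pdivrMr // mul1r lerDr mulr_ge0 ?sqr_ge0.
have [r [rE rhor r1 aA rJ]] := rate_root J0 J12 rho01 A0rho al01 Aal.
rewrite /z -rE.
(* [s / (2 D^2 + s mu)] increases with [s], and at [s = mutmin / 2] half of the decrease rate is
   exactly [J]. *)
have kapJ : 1 - s * mu / (2 * Dmax ^+ 2 + s * mu) / 2 * alpha <= r ^+ 2.
  apply: le_trans rJ; rewrite lerD2l lerN2 ler_wpM2r ?(ltW al0) //.
  have den1 : 0 < 2 * Dmax ^+ 2 + s * mu.
    by rewrite ltr_wpDl ?mulr_gt0 // mulr_ge0 ?sqr_ge0.
  rewrite -/J /J /Jc mul1r mulrC ler_pM2r // ler_pdivrMr // mulrAC ler_pdivlMr //.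
  have h1 : 0 <= 2 * Dmax ^+ 2 * mu * (2 * s - mutmin).
    rewrite mulr_ge0 //; last by lra.
    by rewrite mulr_ge0 ?(ltW mu0) // mulr_ge0 ?sqr_ge0.
  lra.
have lead : alpha ^+ 2 * S <= (r - rho) ^+ 4.
  have aA0 : 0 <= alpha * A by rewrite mulr_ge0 ?sqrtr_ge0 // ltW.
  have -> : alpha ^+ 2 * S = (alpha * A) ^+ 2 by rewrite exprMn AS.
  have -> : (r - rho) ^+ 4 = ((r - rho) ^+ 2) ^+ 2 by rewrite -exprM.
  by rewrite ler_pXn2r ?nnegrE ?sqr_ge0.
move=> i.
have [C HC] := sonata_rate hm K0 clK cK cG Fg mu0 Fcont Fmu psig Hself minmut0
  psimut HDl Dmax0 HDabs (ltW Lmax0) gfL W0 Wr Wc rho0 Wrho (ltW al0) (ltW al1)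
  Kx0 y0 xhat_min x_next y_next al0 s0 rhor r1 gpE kapJ lead i.
by exists C, 0%N => nu _; exact: HC.
Qed.
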